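(* Let $0<R_1<R_2$ and fix $\alpha,\beta\in\mathbb{R}$. Let $$\Lambda(\Omega)=\inf_{v\in V_0(\Omega)\setminus\{0\}}\frac{\|\nabla v\|_{L^2(\Omega)}^2}{\|v\|_{L^2(\Omega)}^2},\qquad M_{\rm out}(\alpha,\beta)=\left[\alpha^2\frac{R_2^4}{(R_2^2-R_1^2)^2R_1^2}+\frac{\beta^2}{16}\left(\frac{R_2^2-R_1^2}{R_1\log(R_2^2/R_1^2)}-R_1\right)^2\right]^{1/2}.$$ Assume that $(v,q)\in V_0(\Omega)\times L^2(\Omega)$ is such that $(u,p)=(\mathcal{U}_{\alpha,\beta}+v,\mathcal{P}_{\alpha,\beta}+q)$ solves $$-\Delta u+u\cdot\nabla u+\nabla p=0,\quad \nabla\cdot u=0\ \text{ in }\Omega,\qquad u=\alpha e_\theta\ \text{ on }\Gamma_1,\qquad u=0\ \text{ on }\Gamma_2 .$$ If $M_{\rm out}(\alpha,\beta)<\Lambda(\Omega)$, then $(v,q)\equiv(0,0)$ in $\Omega$. In particular, the result (i.e. $(v,q)\equiv(0,0)$ in $\Omega$) holds if $$M_{\rm out}(\alpha,\beta)<\max\left\{\frac{\pi^2}{2R_2^2},\ \frac{8}{(R_2^2-R_1^2)\log(R_2/R_1)}\right\}.$$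
   Context: For $0<R_1<R_2$, $\Omega=\{(x,y,z)\in\mathbb{R}^3: R_1^2<x^2+y^2<R_2^2\}$, and $\Gamma_i=\{(x,y,z)\in\mathbb{R}^3: x^2+y^2=R_i^2\}$ for $i=1,2$. Cylindrical coordinates $(\rho,\theta,z)$ are used, with $e_\theta=(-\sin\theta,\cos\theta,0)$ and $e_z=(0,0,1)$. Solutions $(u,p)$ are classical (smooth up to the boundary, which is automatic by standard regularity theory). $V_0(\Omega)=\{v\in H^1_0(\Omega): \nabla\cdot v=0\text{ in }\Omega\}$ (vector fields with values in $\mathbb{R}^3$); one has $\Lambda(\Omega)>0$. For $\rho\in[R_1,R_2]$, $z\in\mathbb{R}$: $$\mathcal{U}_{\alpha,\beta}(\rho)=\alpha\,\mathcal{U}^C(\rho)\,e_\theta+\beta\,\mathcal{U}^P(\rho)\,e_z,\qquad \mathcal{P}_{\alpha,\beta}(\rho,z)=\alpha^2\mathcal{P}^C(\rho)+\beta z,$$ $$\mathcal{U}^C(\rho)=\frac{R_1}{R_2^2-R_1^2}\Big(\frac{R_2^2}{\rho}-\rho\Big),\qquad \mathcal{P}^C(\rho)=\frac12\Big[\frac{R_1}{R_2^2-R_1^2}\Big]^2\Big(\rho^2-\frac{R_2^4}{\rho^2}-4R_2^2\log\rho\Big),$$ $$\mathcal{U}^P(\rho)=\frac14\Big(\rho^2-R_1^2-\frac{R_2^2-R_1^2}{\log(R_2/R_1)}\log(\rho/R_1)\Big).$$ *)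

(* Defs.v *)
From HB Require Import structures.
From mathcomp Require Import all_boot all_order all_algebra.
From mathcomp Require Import all_classical all_reals all_analysis.
Import Order.TTheory GRing.Theory Num.Theory.
Import numFieldNormedType.Exports.

Set Implicit Arguments.
Unset Strict Implicit.
Unset Printing Implicit Defensive.

Local Open Scope classical_set_scope.
Local Open Scope ring_scope.

Notation R3 R := (R * R * R)%type.

Section Calculus.
Context {R : realType}.
Implicit Types (D : set (R3 R)) (f g p q phi : R3 R -> R) (u v : R3 R -> R3 R)
  (x : R3 R) (i k : 'I_3).

Definition coord3 k x : R := tnth [tuple x.1.1; x.1.2; x.2] k.

Definition unit_vec k : R3 R :=
  ((k == 0%N :> nat)%:R, (k == 1%N :> nat)%:R, (k == 2%N :> nat)%:R).

Definition component v k : R3 R -> R := fun x => coord3 k (v x).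

Definition pderiv i f : R3 R -> R := fun x => 'D_(unit_vec i) f x.

Definition pderivs (s : seq 'I_3) f : R3 R -> R := foldr pderiv f s.

(* Existence and continuity of all the iterated partial derivatives, which for
   D open amounts to f being C^oo on D. *)
Definition smooth_on D f : Prop :=
  forall s x, D x ->
    {for x, continuous (pderivs s f)} /\
    forall i, derivable (pderivs s f) x (unit_vec i).

(* f is in C^oo(closure D): the derivatives are taken at the points of D only,
   and each of them extends continuously to the closure of D.  The values of f
   itself on the boundary are its own boundary values. *)
Definition smooth_upto_boundary D f : Prop :=
  [/\ smooth_on D f,
      {within closure D, continuous f} &
      forall s, exists g, {within closure D, continuous g} /\
        forall x, D x -> g x = pderivs s f x].

Definition laplacian f : R3 R -> R := fun x => \sum_(i < 3) pderiv i (pderiv i f) x.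

Definition divergence u : R3 R -> R := fun x => \sum_(i < 3) pderiv i (component u i) x.

(* the k-th component of (u . grad) u *)
Definition convection u k : R3 R -> R :=
  fun x => \sum_(i < 3) component u i x * pderiv i (component u k) x.

Definition classical_steady_NS D u p : Prop :=
  [/\ forall k, smooth_upto_boundary D (component u k),
      smooth_upto_boundary D p,
      forall x, D x -> forall k,
        - laplacian (component u k) x + convection u k x + pderiv k p x = 0 &
      forall x, D x -> divergence u x = 0].

End Calculus.

Section Sobolev.
Context {R : realType}.
Implicit Types (D : set (R3 R)) (f g phi : R3 R -> R) (v : R3 R -> R3 R)
  (i k : 'I_3).

Definition lebesgue3 : set (R3 (measurableTypeR R)) -> \bar R :=
  (@lebesgue_measure R \x @lebesgue_measure R \x @lebesgue_measure R)%E.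

HB.instance Definition _ := Measure.on lebesgue3.

(* Functions are total; only their values on D matter, hence the restrictions. *)
Definition L2 D f : Prop := f \_ D \in Lfun lebesgue3 2%:E.

Definition L2norm D f : \bar R := 'N[lebesgue3]_2%:E[EFin \o f \_ D].

Definition test_function D phi : Prop :=
  [/\ smooth_on setT phi,
      compact (closure [set x | phi x != 0]) &
      closure [set x | phi x != 0] `<=` D].

Definition is_weak_pderiv D i f g : Prop :=
  forall phi, test_function D phi ->
    \int[lebesgue3]_(x in D) (f x * pderiv i phi x) =
    - \int[lebesgue3]_(x in D) (g x * phi x).

Definition H1 D f : Prop :=
  L2 D f /\ forall i, exists g, L2 D g /\ is_weak_pderiv D i f g.

(* A representative, unique up to a.e. equality on D when f is in H1 D. *)
Definition weak_pderiv D i f : R3 R -> R :=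
  get [set g | L2 D g /\ is_weak_pderiv D i f g].

(* the closure of the test functions for the H1 norm *)
Definition H10 D f : Prop :=
  H1 D f /\ exists phi_ : nat -> R3 R -> R,
    [/\ forall n, test_function D (phi_ n),
        L2norm D (phi_ n \- f) @[n --> \oo] --> 0%E &
        forall i, L2norm D (pderiv i (phi_ n) \- weak_pderiv D i f)
          @[n --> \oo] --> 0%E].

Definition V0 D v : Prop :=
  (forall k, H10 D (component v k)) /\
  {ae lebesgue3, forall x, D x -> \sum_(i < 3) weak_pderiv D i (component v i) x = 0}.

Definition sqnorm D v : R := \sum_(k < 3) fine (L2norm D (component v k)) ^+ 2.

Definition sqnorm_grad D v : R :=
  \sum_(k < 3) \sum_(i < 3) fine (L2norm D (weak_pderiv D i (component v k))) ^+ 2.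

Definition Lambda D : R :=
  inf [set sqnorm_grad D v / sqnorm D v | v in
    [set v | V0 D v /\ ~ {ae lebesgue3, forall x, D x -> v x = 0}]].

End Sobolev.

Section CylindricalAnnulus.
Context {R : realType}.
Variables (R1 R2 : R).
Implicit Types (x : R3 R) (alpha beta r z : R).

Definition annulus : set (R3 R) :=
  [set x | R1 ^+ 2 < x.1.1 ^+ 2 + x.1.2 ^+ 2 < R2 ^+ 2].

Definition cylinder r : set (R3 R) :=
  [set x | x.1.1 ^+ 2 + x.1.2 ^+ 2 = r ^+ 2].

Definition rho x : R := Num.sqrt (x.1.1 ^+ 2 + x.1.2 ^+ 2).

(* (- sin theta, cos theta, 0), with cos theta = x / rho, sin theta = y / rho *)
Definition e_theta x : R3 R := (- (x.1.2 / rho x), x.1.1 / rho x, 0).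

Definition e_z : R3 R := (0, 0, 1).

Definition UC r : R := R1 / (R2 ^+ 2 - R1 ^+ 2) * (R2 ^+ 2 / r - r).

Definition PC r : R :=
  2^-1 * (R1 / (R2 ^+ 2 - R1 ^+ 2)) ^+ 2 *
  (r ^+ 2 - R2 ^+ 4 / r ^+ 2 - 4 * R2 ^+ 2 * ln r).

Definition UP r : R :=
  4^-1 * (r ^+ 2 - R1 ^+ 2 -
          (R2 ^+ 2 - R1 ^+ 2) / ln (R2 / R1) * ln (r / R1)).

Definition baseU alpha beta x : R3 R :=
  (alpha * UC (rho x)) *: e_theta x + (beta * UP (rho x)) *: e_z.

Definition baseP alpha beta x : R := alpha ^+ 2 * PC (rho x) + beta * x.2.

Definition Mout alpha beta : R :=
  Num.sqrt (alpha ^+ 2 * (R2 ^+ 4 / ((R2 ^+ 2 - R1 ^+ 2) ^+ 2 * R1 ^+ 2)) +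
    beta ^+ 2 / 16 *
      ((R2 ^+ 2 - R1 ^+ 2) / (R1 * ln (R2 ^+ 2 / R1 ^+ 2)) - R1) ^+ 2).

End CylindricalAnnulus.

(* Main.v *)
From HB Require Import structures.
Require Import Defs.
From mathcomp Require Import all_boot all_order all_algebra.
From mathcomp Require Import all_classical all_reals all_analysis.
From mathcomp Require Import measurable_realfun ring lra.
Import Order.TTheory GRing.Theory Num.Theory.
Import numFieldNormedType.Exports.

Local Open Scope classical_set_scope.
Local Open Scope ring_scope.

(** The perturbation [v] satisfies the energy balance
    [|grad v|^2 = - int (v . grad U) . v], where [U] is the base flow: test the
    equation with the approximations [phi_n -> v] in [H^1_0] and let [n -> oo].
    The pressure disappears because [q] is in [L^2] and [div phi_n -> div v = 0];
    the transport term is [int ((grad v - grad phi_n) u) . phi_n], since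
    [int (u . grad phi_n) . phi_n = 0], and tends to [0] because [u phi_n] is
    bounded in [L^2], by Ladyzhenskaya's inequality in [L^4].  In cylindrical
    coordinates [(v . grad U) . v = v_rho (A v_theta + B v_z)], and
    [sqrt (A^2 + B^2) / 2 <= Mout] on the annulus, so that
    [|grad v|^2 <= Mout |v|^2] and [v = 0] as soon as [Mout] is less than a
    Poincare constant.  Explicit constants come from Barta's argument: if
    [w > 0] and [- laplacian w >= lambda w], then
    [|grad phi|^2 >= lambda |phi|^2].  Finally [grad q = 0], and an [L^2] function
    that does not depend on [z] vanishes. *)

(** * Measurability of continuous functions *)

(** The obstacle is that the domain is unbounded in z and that [v] is only a limit of test functions
    in H^1: nothing bounds u as |z| grows, and the classical equation can be tested only with
    compactly supported functions. The approximations phi_n are not divergence free, so the pressure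
    is carried along to the limit, where it cancels only in the sum over the three components. The
    weak gradient of [v] and the classical gradient of its smooth copy on the domain are compared
    through integrals against test functions. The factor 1/2 in front of sqrt (A^2 + B^2) comes from
    2 |v_rho| |(v_theta, v_z)| <= |v|^2. The number [Mout] is the value of sqrt (A^2 + B^2) / 2 at
    rho = R1, where |A| and |B| are both largest: |A| decreases with rho, while for B this is the
    inequality between the geometric and the logarithmic mean of R1^2 and R2^2. Barta's argument is
    applied with F = grad w / w. The weight is a product of two cosines for the constant with pi;
    the other constant is the inverse of an upper bound for the torsion function of the annulus. *)

Section MeasurableBase.

(** A countable neighbourhood base of measurable sets reconciles the product topology with the
    product sigma-algebra: an open set is the union of the base elements that it contains, hence
    measurable. *)
Definition measurable_base {T : topologicalType} (m : set (set T))
    (B : nat -> set T) :=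
  (forall n, m (B n)) /\
  forall x U, nbhs x U -> exists n, B n x /\ B n `<=` U.

Lemma measurable_baseR (R : realType) :
  exists B, @measurable_base R (@measurable _ (measurableTypeR R)) B.
Proof.
pose B n : set R := if unpickle n is Some (p, q) then
  `](ratr p : R), (ratr q : R)[%classic else set0.
exists B; split => [n|x U].
  by rewrite /B; case: (unpickle n) => [[p q]|] //; exact: measurable_itv.
rewrite -nbhs_ballE => -[e /= e0 xU].
have [p] : exists p : rat, ratr p \in `]x - e, x[.
  by apply/rat_in_itvoo; rewrite ltrBlDr ltrDl.
rewrite in_itv/= => /andP[p1 p2].
have [q] : exists q : rat, ratr q \in `]x, x + e[.
  by apply/rat_in_itvoo; rewrite ltrDl.
rewrite in_itv/= => /andP[q1 q2].
exists (pickle (p, q)); rewrite /B pickleK; split => /=.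
  by rewrite in_itv/= p2 q1.
move=> y; rewrite /= in_itv/= => /andP[py yq]; apply: xU.
by rewrite /ball/= ltr_distl; lra.
Qed.

Lemma measurable_base_prod (S T : topologicalType) mS mT mST BS BT :
  @measurable_base S mS BS -> @measurable_base T mT BT ->
  (forall A B, mS A -> mT B -> mST (A `*` B)) ->
  exists B, @measurable_base (S * T)%type mST B.
Proof.
move=> [mBS bS] [mBT bT] mX.
(* Only rectangles are known to lie in [mST], so a number that codes no pair is sent to a rectangle
   as well. *)
pose B n : set (S * T) := if unpickle n is Some (p, q) then BS p `*` BT q
  else BS 0%N `*` BT 0%N.
exists B; split => [n|[x y] U].
  by rewrite /B; case: (unpickle n) => [[p q]|] //; exact: mX.
move=> [[P Q] /= [xP yQ] PQU].
have [p [Bpx pP]] := bS _ _ xP.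
have [q [Bqy qQ]] := bT _ _ yQ.
exists (pickle (p, q)); rewrite /B pickleK; split => //.
by move=> [x' y'] [/= /pP Px' /qQ Qy']; exact: PQU.
Qed.

End MeasurableBase.

Section Measurability3.
Context {R : realType}.
Implicit Types (D : set (R3 R)) (f g h : R3 R -> R).

Notation mR3 := (R3 (measurableTypeR R)).

Lemma measurable_base3 :
  exists B, @measurable_base (R3 R) (@measurable _ mR3) B.
Proof.
have [B bB] := measurable_baseR R.
have [B2 bB2] := @measurable_base_prod _ _ _ _
  (@measurable _ (measurableTypeR R * measurableTypeR R)%type) _ _ bB bB
  (@measurableX _ _ (measurableTypeR R) (measurableTypeR R)).
exact: (@measurable_base_prod _ _ _ _ (@measurable _ mR3) _ _ bB2 bB
  (@measurableX _ _ (measurableTypeR R * measurableTypeR R)%type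
    (measurableTypeR R))).
Qed.

Lemma open_measurable3 D : open D -> @measurable _ mR3 D.
Proof.
move=> oD; have [B [mB bB]] := measurable_base3.
have -> : D = \bigcup_(n in [set n | B n `<=` D]) B n.
  apply/seteqP; split => x.
    move=> Dx; have [n [Bnx nD]] := bB x D (open_nbhs_nbhs (conj oD Dx)).
    by exists n.
  by move=> [n nD Bnx]; exact: nD.
by apply: bigcup_measurable => n _; exact: mB.
Qed.

Lemma continuous_measurable3 D f : open D ->
  (forall x, D x -> {for x, continuous f}) ->
  @measurable_fun _ _ mR3 (measurableTypeR R) D f.
Proof.
move=> oD cf; apply: (measurability _ (measurable_realfun.RGenOpens.measurableE R)).
move=> /= _ [_ [a [b ->] <-]].
apply: open_measurable3.
rewrite openE => x [Dx /= fx]; apply: filterI.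
  exact: open_nbhs_nbhs.
apply: (cf x Dx); apply: open_nbhs_nbhs; split => //; exact: interval_open.
Qed.

End Measurability3.

Lemma bounded_support_integrable d (T : measurableType d) (R : realType)
    (mu : {measure set T -> \bar R}) (A : set T) (f : T -> R) (B : R) :
  measurable A -> (mu A < +oo)%E -> measurable_fun setT f ->
  (forall x, `|f x| <= B) -> (forall x, ~ A x -> f x = 0) ->
  mu.-integrable setT (EFin \o f).
Proof.
move=> mA Afin mf fB f0.
have -> : f = f \_ A.
  by apply/funext => x; rewrite patchE; case: ifPn => // /negP; rewrite inE => /f0.
rewrite -restrict_EFin; apply: (iffLR (integrable_mkcond _ mA)).
apply: measurable_bounded_integrable => //; first exact: measurable_funTS.
exists B; split; first exact: num_real.
by move=> C BC x _; apply: (le_trans (fB x)); exact: ltW.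
Qed.

(** * Continuous functions of compact support *)

Section CompactlySupported.
Context {R : realType}.
Implicit Types (D : set (R3 R)) (f g h : R3 R -> R) (M : R).

Definition box M : set (R3 R) :=
  `[- M, M]%classic `*` `[- M, M]%classic `*` `[- M, M]%classic.

(** Vanishing outside a cube, instead of compactness of the support, is a condition that passes at
    once to the one- and two-dimensional slices to which Fubini's theorem leads. *)
Definition continuous_csupp h :=
  continuous h /\ exists M, forall x, ~ box M x -> h x = 0.

Lemma boxP M (x y z : R) :
  box M (x, y, z) <-> [/\ `|x| <= M, `|y| <= M & `|z| <= M].
Proof. by rewrite /box /= !in_itv/= !ler_norml; split => [[[-> ->] ->]|[-> -> ->]]. Qed.

Lemma box_measurable M : @measurable _ (R3 (measurableTypeR R)) (box M).
Proof. by apply: measurableX => //; apply: measurableX. Qed.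

Lemma box_finite M : (lebesgue3 (box M) < +oo)%E.
Proof.
rewrite /lebesgue3 product_measure1E//=; last exact: measurableX.
by rewrite product_measure1E//= !lebesgue_measure_itv/=; case: ifP => _;
  rewrite ?mul0e// -!EFinM ltry.
Qed.

Lemma box_compact M : compact (box M).
Proof. by apply: compact_setX; [apply: compact_setX|]; exact: segment_compact. Qed.

Lemma csupp_measurable h : continuous_csupp h ->
  @measurable_fun _ _ (R3 (measurableTypeR R)) (measurableTypeR R) setT h.
Proof.
by move=> [ch _]; apply: continuous_measurable3 => [|x _]; [exact: openT|exact: ch].
Qed.

Lemma csupp_bounded h : continuous_csupp h ->
  exists2 B : R, 0 <= B & forall x, `|h x| <= B.
Proof.
move=> [ch [M hM]].
have : compact (h @` box M).
  by apply: continuous_compact; [exact: continuous_subspaceT|exact: box_compact].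
move=> /compact_bounded[B [Breal hB]].
exists (`|B| + 1) => [|x]; first by rewrite addr_ge0.
have [bx|/hM ->] := pselect (box M x); last by rewrite normr0 addr_ge0.
by apply: (hB (`|B| + 1)); [rewrite ltr_pwDr ?ler_norm|exists x].
Qed.

Lemma csupp_integrable h : continuous_csupp h ->
  lebesgue3.-integrable setT (EFin \o h).
Proof.
move=> hc; have [B B0 hB] := csupp_bounded _ hc.
have [_ [M hM]] := hc.
exact: (bounded_support_integrable _ _ _ _ _ _ _ (box_measurable M)
  (box_finite M) (csupp_measurable _ hc) hB hM).
Qed.

Lemma csupp_mul f g : continuous f -> continuous_csupp g ->
  continuous_csupp (fun x => f x * g x).
Proof.
move=> cf [cg [M gM]]; split; first by move=> x; exact: (continuousM (cf x) (cg x)).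
by exists M => x /gM ->; rewrite mulr0.
Qed.

Lemma csupp_add f g : continuous_csupp f -> continuous_csupp g ->
  continuous_csupp (fun x => f x + g x).
Proof.
move=> [cf [M fM]] [cg [N gN]]; split.
  by move=> x; exact: (continuousD (cf x) (cg x)).
exists (Num.max M N) => -[[x y] z] nb; rewrite fM ?gN ?addr0//.
  move=> /boxP[xN yN zN]; apply: nb; apply/boxP.
  by rewrite !le_max xN yN zN !orbT.
move=> /boxP[xN yN zN]; apply: nb; apply/boxP.
by rewrite !le_max xN yN zN.
Qed.

Lemma csupp_closure_compact h : continuous h ->
  compact (closure [set x | h x != 0]) -> continuous_csupp h.
Proof.
move=> ch /compact_bounded[B [Breal hB]]; split=> //.
exists (`|B| + 1) => -[[x y] z] nb; apply/eqP/negP => /negP h0; apply: nb.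
have : `|(x, y, z)| <= `|B| + 1.
  apply: (hB (`|B| + 1)); first by rewrite ltr_pwDr ?ler_norm.
  exact: subset_closure.
rewrite /Num.norm/= /Num.norm/=.
rewrite !ge_max => /andP[/andP[xB yB] zB].
by apply/boxP.
Qed.

End CompactlySupported.

(** * Smooth functions and test functions *)

Section SmoothCalculus.
Context {R : realType}.
Implicit Types (D E : set (R3 R)) (f g h phi : R3 R -> R) (i k : 'I_3).

(** [smooth_on] speaks of all iterated derivatives at once, which gives no induction for products,
    inverses or compositions: the derivative of 1/f again contains 1/f. Counting the derivatives
    makes these inductions possible. *)
Fixpoint Ck (n : nat) D f : Prop :=
  (forall x, D x -> {for x, continuous f}) /\
  if n is m.+1 then
    (forall x i, D x -> derivable f x (unit_vec i)) /\
    forall i, Ck m D (pderiv i f)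
  else True.

Lemma Ck_continuous n D f x : Ck n D f -> D x -> {for x, continuous f}.
Proof. by case: n => [|n] [cf _]; exact: cf. Qed.

Lemma CkS n D f : Ck n.+1 D f <->
  [/\ forall x, D x -> {for x, continuous f},
      forall x i, D x -> derivable f x (unit_vec i) &
      forall i, Ck n D (pderiv i f)].
Proof. by split=> [[? []]|[]]. Qed.

Lemma CkW n D f : Ck n.+1 D f -> Ck n D f.
Proof.
elim: n f => [f /CkS[cf _ _] //|n IH f /CkS[cf df Cf]]; apply/CkS; split => // i.
exact: IH.
Qed.

(** Regularity is local, so it can be glued. This serves for extension by zero, with [E] the
    complement of a support. *)
Lemma Ck_setU n D E f : Ck n D f -> Ck n E f -> Ck n (D `|` E) f.
Proof.
elim: n f => [f [cf _] [cf' _]|n IH f /CkS[cf df Cf] /CkS[cf' df' Cf']].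
  by split => // x [/cf|/cf'].
by apply/CkS; split => [x [/cf|/cf'] //|x i [/(df _ i)|/(df' _ i)] //|i]; exact: IH.
Qed.

Lemma smooth_pderiv D f i : smooth_on D f -> smooth_on D (pderiv i f).
Proof.
by move=> sf s x Dx; have := sf (rcons s i) x Dx; rewrite /pderivs foldr_rcons.
Qed.

Lemma smoothP D f : smooth_on D f <-> forall n, Ck n D f.
Proof.
split=> [sf n|Cf s].
  elim: n f sf => [f sf|n IH f sf]; first by split => // x Dx; exact: (sf [::] x Dx).1.
  apply/CkS; split => [x Dx|x i Dx|i]; [exact: (sf [::] x Dx).1| |].
    exact: (sf [::] x Dx).2.
  exact/IH/smooth_pderiv.
elim/last_ind: s f Cf => [f Cf x Dx|s i IH f Cf x Dx].
  by have /CkS[cf df _] := Cf 1%N; split => [|i]; [exact: cf|exact: df].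
rewrite /pderivs foldr_rcons; apply: IH => // n.
by have /CkS[] := Cf n.+1.
Qed.

Lemma smooth_derivable D f x i : smooth_on D f -> D x ->
  derivable f x (unit_vec i).
Proof. by move=> sf Dx; exact: (sf [::] x Dx).2. Qed.

Lemma smooth_continuous D f x : smooth_on D f -> D x -> {for x, continuous f}.
Proof. by move=> sf Dx; exact: (sf [::] x Dx).1. Qed.

Lemma unit_vec_neq0 i : unit_vec i != 0 :> R3 R.
Proof.
apply/eqP => /(congr1 (coord3 i)); rewrite /unit_vec /coord3.
case: i => [[|[|[|//]]] ?] /=; rewrite !(tnth_nth 0)/= => /eqP; rewrite oner_eq0//.
Qed.

Lemma pderiv_near f g x i : {near x, f =1 g} -> pderiv i f x = pderiv i g x.
Proof. by move=> fg; apply: near_eq_derive => //; exact: unit_vec_neq0. Qed.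

Lemma derivable_near f g x i : {near x, f =1 g} ->
  derivable f x (unit_vec i) -> derivable g x (unit_vec i).
Proof. by move=> fg; apply: near_eq_derivable => //; exact: unit_vec_neq0. Qed.

Lemma open_near_eq D f g x : open D -> (forall y, D y -> f y = g y) -> D x ->
  {near x, f =1 g}.
Proof.
by move=> oD fg Dx; apply: filterS (open_nbhs_nbhs (conj oD Dx)) => y; exact: fg.
Qed.

Lemma pderiv_open D f g x i : open D -> (forall y, D y -> f y = g y) -> D x ->
  pderiv i f x = pderiv i g x.
Proof. by move=> oD fg Dx; apply: pderiv_near; exact: (open_near_eq D). Qed.

Lemma Ck_eq n D f g : open D -> (forall x, D x -> f x = g x) ->
  Ck n D f -> Ck n D g.
Proof.
move=> oD; elim: n f g => [f g fg [cf _]|n IH f g fg /CkS[cf df Cf]].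
  split => // x Dx; rewrite /prop_for /continuous_at -(fg x Dx).
  by apply: cvg_trans (cf x Dx); apply: near_eq_cvg; exact: (open_near_eq D).
apply/CkS; split => [x Dx|x i Dx|i].
- rewrite /prop_for /continuous_at -(fg x Dx).
  by apply: cvg_trans (cf x Dx); apply: near_eq_cvg; exact: (open_near_eq D).
- by apply: derivable_near (df x i Dx); exact: (open_near_eq D).
- by apply: (IH (pderiv i f)) => // x Dx; exact: (pderiv_open D).
Qed.

Lemma pderiv_cst (c : R) i : pderiv i (cst c : R3 R -> R) = cst 0.
Proof. by apply/funext => x; rewrite /pderiv derive_cst. Qed.

Lemma Ck_cst n D (c : R) : Ck n D (cst c).
Proof.
elim: n c => [c|n IH c]; first by split => // x _; exact: cvg_cst.
apply/CkS; split => [x _|x i _|i]; [exact: cvg_cst|exact: derivable_cst|].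
by rewrite pderiv_cst.
Qed.

Lemma Ck_add n D f g : open D -> Ck n D f -> Ck n D g -> Ck n D (f \+ g).
Proof.
move=> oD; elim: n f g => [f g [cf _] [cg _]|n IH f g /CkS[cf df Cf] /CkS[cg dg Cg]].
  by split=> // x Dx; exact: (continuousD (cf x Dx) (cg x Dx)).
apply/CkS; split => [x Dx|x i Dx|i].
- exact: (continuousD (cf x Dx) (cg x Dx)).
- exact: (derivableD (df x i Dx) (dg x i Dx)).
- apply: Ck_eq (IH _ _ (Cf i) (Cg i)) => // x Dx /=.
  by rewrite /pderiv (deriveD (df x i Dx) (dg x i Dx)).
Qed.

Lemma Ck_mul n D f g : open D -> Ck n D f -> Ck n D g -> Ck n D (f \* g).
Proof.
move=> oD; elim: n f g => [f g [cf _] [cg _]|n IH f g Cf' Cg'].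
  by split=> // x Dx; exact: (continuousM (cf x Dx) (cg x Dx)).
have /CkS[cf df Cf] := Cf'; have /CkS[cg dg Cg] := Cg'.
apply/CkS; split => [x Dx|x i Dx|i].
- exact: (continuousM (cf x Dx) (cg x Dx)).
- exact: (derivableM (df x i Dx) (dg x i Dx)).
- apply: Ck_eq (Ck_add _ _ _ _ oD (IH _ _ (CkW _ _ _ Cf') (Cg i))
    (IH _ _ (CkW _ _ _ Cg') (Cf i))) => // x Dx /=.
  by rewrite /pderiv (deriveM (df x i Dx) (dg x i Dx)).
Qed.

Lemma Ck_opp n D f : open D -> Ck n D f -> Ck n D (\- f).
Proof.
move=> oD Cf; apply: Ck_eq (Ck_mul _ _ _ _ oD (Ck_cst n D (-1)) Cf) => // x _ /=.
by rewrite mulN1r.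
Qed.

Lemma is_derive_pderiv f x i : derivable f x (unit_vec i) ->
  is_derive x (unit_vec i) f (pderiv i f x).
Proof. exact: derivableP. Qed.

Lemma Ck_inv n D f : open D -> (forall x, D x -> f x != 0) -> Ck n D f ->
  Ck n D (fun x => (f x)^-1).
Proof.
move=> oD f0; elim: n => [[cf _]|n IH Cf'].
  by split=> // x Dx; exact: (continuousV (f0 x Dx) (cf x Dx)).
have /CkS[cf df Cf] := Cf'.
have {}IH := IH (CkW _ _ _ Cf').
apply/CkS; split => [x Dx|x i Dx|i].
- exact: (continuousV (f0 x Dx) (cf x Dx)).
- exact: (derivableV (f0 x Dx) (df x i Dx)).
- apply: (Ck_eq _ _ _ _ oD _ (Ck_opp _ _ _ oD
    (Ck_mul _ _ _ _ oD (Cf i) (Ck_mul _ _ _ _ oD IH IH)))) => x Dx /=.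
  rewrite /pderiv (deriveV (f0 x Dx) (df x i Dx)) scaleNr /=.
  by rewrite expr2 invfM /GRing.scale/= mulrC.
Qed.

(** The two difference quotients are the same function. Since the existence of partial derivatives
    does not give differentiability, the chain rule and the fundamental theorem of calculus are
    applied on lines, in one variable. *)
Lemma is_derive_line f (x v : R3 R) (t df : R) :
  is_derive (t *: v + x) v f df <-> is_derive t 1 (fun s : R => f (s *: v + x)) df.
Proof.
have E : (fun h : R => h^-1 *: ((f \o shift (t *: v + x)) (h *: v) - f (t *: v + x)))
  = (fun h : R => h^-1 *: (((fun s : R => f (s *: v + x)) \o shift t) (h *: 1)
      - f (t *: v + x))).
  apply/funext => h; congr (_ *: (f _ - _)).
  by rewrite /= addrA scalerDl /GRing.scale/= mulr1.
by split=> -[df1 df2]; split; move: df1 df2; rewrite /derivable /derive E.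
Qed.

Lemma is_derive_comp_real f (g : R -> R) (x v : R3 R) (df dg : R) :
  is_derive x v f df -> is_derive (f x) 1 g dg ->
  is_derive x v (fun y => g (f y)) (dg * df).
Proof.
rewrite -{1}[x]add0r -{1}(scale0r v) => /is_derive_line[fl fE] gx.
rewrite -[x]add0r -(scale0r v); apply/is_derive_line.
have [gx1 gx2] := gx.
have gx' : derivable g ((fun s : R => f (s *: v + x)) 0) 1.
  by rewrite /= scale0r add0r.
have [d1 d2] := (derive1_comp fl gx', fl); split.
  by apply/derivable1_diffP; apply: differentiable_comp; apply/derivable1_diffP.
rewrite -derive1E [LHS]d1 !derive1E fE /= scale0r add0r.
by rewrite gx2.
Qed.

Lemma continuous_comp_real f (g : R -> R) (x : R3 R) :
  {for x, continuous f} -> {for f x, continuous g} ->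
  {for x, continuous (fun y => g (f y))}.
Proof. exact: continuous_comp. Qed.

Lemma Ck_ln n D f : open D -> (forall x, D x -> 0 < f x) -> Ck n D f ->
  Ck n D (fun x => ln (f x)).
Proof.
move=> oD f0 Cf'.
have fc x : D x -> {for x, continuous (fun y => ln (f y))}.
  move=> Dx; apply: continuous_comp_real; first exact: Ck_continuous Cf' Dx.
  by apply: continuous_ln; exact: f0.
case: n Cf' => [//|n Cf']; have /CkS[cf df Cf] := Cf'.
have dln x i : D x ->
    is_derive x (unit_vec i) (fun y => ln (f y)) ((f x)^-1 * pderiv i f x).
  move=> Dx; apply: is_derive_comp_real; last exact/is_derive1_ln/f0.
  exact/is_derive_pderiv/df.
apply/CkS; split => [x Dx|x i Dx|i]; first exact: fc.
  by have [] := dln x i Dx.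
have f1 x : D x -> f x != 0 by move=> /f0; exact: lt0r_neq0.
apply: (Ck_eq _ _ _ _ oD _ (Ck_mul _ _ _ _ oD
  (Ck_inv _ _ _ oD f1 (CkW _ _ _ Cf')) (Cf i))) => x Dx /=.
by rewrite /pderiv; have [_ ->] := dln x i Dx.
Qed.

Lemma coord3_linear k (x y : R3 R) (a : R) :
  coord3 k (a *: x + y) = a * coord3 k x + coord3 k y.
Proof. by rewrite /coord3; case: k => [[|[|[|//]]] ?]; rewrite !(tnth_nth 0). Qed.

Lemma coord3_unit_vec k i : coord3 k (unit_vec i) = (k == i)%:R :> R.
Proof.
by rewrite /coord3 /unit_vec; case: k => [[|[|[|//]]] ?]; rewrite !(tnth_nth 0)/= eq_sym.
Qed.

Lemma coord3_continuous k : continuous (@coord3 R k).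
Proof.
have c1 : continuous (fun x : R3 R => x.1.1).
  by move=> x; apply: continuous_comp; exact: cvg_fst.
have c2 : continuous (fun x : R3 R => x.1.2).
  by move=> x; apply: continuous_comp; [exact: cvg_fst|exact: cvg_snd].
have c3 : continuous (fun x : R3 R => x.2) by move=> x; exact: cvg_snd.
case: k => [[|[|[|//]]] k3]; [have <- : (fun x : R3 R => x.1.1) = coord3 (Ordinal k3)
  |have <- : (fun x : R3 R => x.1.2) = coord3 (Ordinal k3)
  |have <- : (fun x : R3 R => x.2) = coord3 (Ordinal k3)] => //;
  by apply/funext => x; rewrite /coord3 (tnth_nth 0).
Qed.

Lemma is_derive_coord3 k i (x : R3 R) :
  is_derive x (unit_vec i) (@coord3 R k) (k == i)%:R.
Proof.
rewrite -[x]add0r -(scale0r (unit_vec i)); apply/is_derive_line.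
have -> : (fun s : R => coord3 k (s *: unit_vec i + x)) =
    (fun s => s * (k == i)%:R + coord3 k x).
  by apply/funext => s; rewrite coord3_linear coord3_unit_vec.
by apply: is_derive_eq; rewrite /GRing.scale/= mulr0 add0r mulr1 addr0.
Qed.

Lemma Ck_coord3 n D k : Ck n D (@coord3 R k).
Proof.
case: n => [|n]; first by split => // x _; exact: coord3_continuous.
apply/CkS; split => [x _|x i _|i]; first exact: coord3_continuous.
  by have [] := is_derive_coord3 k i x.
have -> : pderiv i (@coord3 R k) = cst (k == i)%:R.
  by apply/funext => x; rewrite /pderiv; have [_ ->] := is_derive_coord3 k i x.
exact: Ck_cst.
Qed.

Lemma smooth_add D f g : open D -> smooth_on D f -> smooth_on D g ->
  smooth_on D (f \+ g).
Proof. by move=> oD /smoothP Cf /smoothP Cg; apply/smoothP => n; exact: Ck_add. Qed.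

Lemma smooth_mul D f g : open D -> smooth_on D f -> smooth_on D g ->
  smooth_on D (f \* g).
Proof. by move=> oD /smoothP Cf /smoothP Cg; apply/smoothP => n; exact: Ck_mul. Qed.

Lemma smooth_opp D f : open D -> smooth_on D f -> smooth_on D (\- f).
Proof. by move=> oD /smoothP Cf; apply/smoothP => n; exact: Ck_opp. Qed.

Lemma smooth_cst D (c : R) : smooth_on D (cst c).
Proof. by apply/smoothP => n; exact: Ck_cst. Qed.

Lemma smooth_coord3 D k : smooth_on D (@coord3 R k).
Proof. by apply/smoothP => n; exact: Ck_coord3. Qed.

Lemma smooth_inv D f : open D -> (forall x, D x -> f x != 0) -> smooth_on D f ->
  smooth_on D (fun x => (f x)^-1).
Proof. by move=> oD f0 /smoothP Cf; apply/smoothP => n; exact: Ck_inv. Qed.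

Lemma smooth_ln D f : open D -> (forall x, D x -> 0 < f x) -> smooth_on D f ->
  smooth_on D (fun x => ln (f x)).
Proof. by move=> oD f0 /smoothP Cf; apply/smoothP => n; exact: Ck_ln. Qed.

Lemma smooth_eq D f g : open D -> (forall x, D x -> f x = g x) ->
  smooth_on D f -> smooth_on D g.
Proof. by move=> oD fg /smoothP Cf; apply/smoothP => n; exact: Ck_eq (Cf n). Qed.

Lemma pderivM D f g x i : smooth_on D f -> smooth_on D g -> D x ->
  pderiv i (f \* g) x = pderiv i f x * g x + f x * pderiv i g x.
Proof.
move=> sf sg Dx; rewrite /pderiv (deriveM (smooth_derivable _ _ _ i sf Dx)
  (smooth_derivable _ _ _ i sg Dx)) /GRing.scale/=.
by rewrite addrC [in LHS]mulrC.
Qed.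

Lemma pderivB D f g x i : smooth_on D f -> smooth_on D g -> D x ->
  pderiv i (f \- g) x = pderiv i f x - pderiv i g x.
Proof.
by move=> sf sg Dx; rewrite /pderiv (deriveB (smooth_derivable _ _ _ i sf Dx)
  (smooth_derivable _ _ _ i sg Dx)).
Qed.

Definition supp f : set (R3 R) := closure [set x | f x != 0].

Lemma notin_supp f x : ~ supp f x -> f x = 0.
Proof.
by move=> nx; apply/eqP/negP => /negP f0; apply: nx; exact: subset_closure.
Qed.

Lemma open_supp_setC f : open (~` supp f).
Proof. exact/closed_openC/closed_closure. Qed.

Lemma test_outside D phi x : test_function D phi -> ~ D x -> phi x = 0.
Proof. by move=> [_ _ sD] nDx; apply: notin_supp => /sD. Qed.

Lemma test_smooth D phi E : test_function D phi -> smooth_on E phi.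
Proof. by move=> [sphi _ _] s x _; exact: sphi. Qed.

Lemma supp_sub f g : (forall x, ~ supp f x -> g x = 0) -> supp g `<=` supp f.
Proof.
move=> fg; rewrite [X in _ `<=` X](closure_id _).1; last exact: closed_closure.
apply: closure_subset => x /= gx.
by apply: contrapT => /fg /eqP; exact/negP.
Qed.

Lemma supp_pderiv i f x : ~ supp f x -> pderiv i f x = 0.
Proof.
move=> fx; rewrite (pderiv_open (~` supp f) f (cst 0)) ?pderiv_cst//.
  exact: open_supp_setC.
by move=> y; exact: notin_supp.
Qed.

Lemma test_pderiv D phi i : test_function D phi -> test_function D (pderiv i phi).
Proof.
move=> [sphi cphi phiD].
have ss : supp (pderiv i phi) `<=` supp phi by apply: supp_sub => x; exact: supp_pderiv.
split; [exact: smooth_pderiv| |exact: subset_trans ss phiD].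
exact: subclosed_compact (@closed_closure _ _) cphi ss.
Qed.

(** A point outside [D] has a neighbourhood that avoids the support of [phi], on which the product
    is zero whatever [f] does there. *)
Lemma continuous_mul_test D f phi : open D ->
  (forall x, D x -> {for x, continuous f}) -> test_function D phi ->
  continuous (f \* phi).
Proof.
move=> oD cf tphi; have [sphi _ phiD] := tphi.
suff key (x : R3 R) : {for x, continuous (f \* phi)} by move=> x; exact: key.
have [Dx|nDx] := pselect (D x).
  exact: (continuousM (cf x Dx) (smooth_continuous _ _ _ sphi I)).
have nx : ~ supp phi x by move/phiD.
have phi0 : phi x = 0 by exact: notin_supp.
have c0 : {for x, continuous (cst 0 : R3 R -> R)} by exact: cvg_cst.
rewrite /prop_for /continuous_at /= phi0 mulr0.
apply: cvg_trans c0; apply: near_eq_cvg.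
apply: filterS (open_nbhs_nbhs (conj (open_supp_setC phi) nx)).
by move=> y /notin_supp /= ->; rewrite mulr0.
Qed.

(** The product is smooth on [D] and zero on the open complement of the support of [phi]; these two
    open sets cover the space. *)
Lemma test_mul D f phi : open D -> smooth_on D f -> test_function D phi ->
  test_function D (f \* phi).
Proof.
move=> oD sf tphi; have [sphi cphi phiD] := tphi.
have ss : supp (f \* phi) `<=` supp phi.
  by apply: supp_sub => x /notin_supp /= ->; rewrite mulr0.
split; [|exact: subclosed_compact (@closed_closure _ _) cphi ss
  |exact: subset_trans ss phiD].
apply/smoothP => n.
have -> : setT = D `|` ~` supp phi.
  apply/esym/seteqP; split=> // x _.
  by have [/phiD|] := pselect (supp phi x); [left|right].
apply: Ck_setU.
  by apply: Ck_mul => //; [have /smoothP := sf|have /smoothP := test_smooth _ _ D tphi]; apply.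
apply: Ck_eq (Ck_cst n (~` supp phi) 0); first exact: open_supp_setC.
by move=> x /notin_supp /= ->; rewrite mulr0.
Qed.

End SmoothCalculus.

(** * Fubini and the fundamental theorem of calculus *)

Section OneDimensional.
Context {R : realType}.
Implicit Types (k dk : R -> R) (M a b x t : R).
Notation mu := (@lebesgue_measure R).

Lemma FTC2_derive k dk a b : a < b ->
  (forall t, is_derive t 1 k (dk t)) -> continuous dk ->
  (\int[mu]_(t in `[a, b]) (dk t)%:E = (k b - k a)%R%:E)%E.
Proof.
move=> ab kdk cdk; rewrite (@continuous_FTC2 _ dk k _ _ ab) ?EFinB//.
- exact: continuous_subspaceT.
- have ck t : {for t, continuous k}.
    by apply: differentiable_continuous; apply/derivable1_diffP; have [] := kdk t.
  split => [t _| |].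
  + by have [] := kdk t.
  + by apply: cvg_at_right_filter; exact: ck.
  + by apply: cvg_at_left_filter; exact: ck.
- by move=> t _; rewrite derive1E; have [_ ->] := kdk t.
Qed.

Lemma integral_derive_csupp k dk M :
  (forall t, is_derive t 1 k (dk t)) -> continuous dk ->
  (forall t, M < `|t| -> k t = 0) -> (forall t, M < `|t| -> dk t = 0) ->
  (\int[mu]_t (dk t)%:E = 0)%E.
Proof.
move=> kdk cdk k0 dk0; pose L : R := `|M| + 1.
have ML : M < L by rewrite ltr_pwDr// ler_norm.
have L0 : 0 < L by rewrite ltr_wpDl.
have -> : (\int[mu]_t (dk t)%:E = \int[mu]_(t in `[(- L)%R, L]) (dk t)%:E)%E.
  rewrite [RHS]integral_mkcond; apply: eq_integral => t _.
  rewrite patchE; case: ifPn => // /negP; rewrite inE/= in_itv/= -ler_norml => /negP.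
  by rewrite -ltNge => /(lt_trans ML)/dk0 ->.
rewrite (FTC2_derive k)//; last by rewrite gtrN.
by rewrite !k0 ?subrr// ?normrN gtr0_norm.
Qed.

Lemma le_integral_derive_csupp k dk M x :
  (forall t, is_derive t 1 k (dk t)) -> continuous dk ->
  (forall t, M < `|t| -> k t = 0) ->
  (`|k x|%:E <= \int[mu]_t `|dk t|%:E)%E.
Proof.
(* The point -L lies to the left of [x] and outside the support, so [k x] is the integral of [dk]
   from -L to [x]. *)
move=> kdk cdk k0; pose L : R := `|M| + `|x| + 1.
have ML : M < L by rewrite /L; have := ler_norm M; have := normr_ge0 x; lra.
have Lx : - L < x.
  by rewrite /L; have := ler_norm (- x); have := normr_ge0 M; rewrite normrN; lra.
have -> : k x = k x - k (- L).
  by rewrite (k0 (- L)) ?subr0// normrN (lt_le_trans ML)// ler_norm.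
have mdk : measurable_fun setT dk by exact: continuous_measurable_fun.
rewrite (_ : (_%:E = `|(k x - k (- L))%:E|)%E)// -(FTC2_derive k dk)//.
apply: (le_trans (le_abse_integral _ _ _)) => //=.
  by apply/measurable_EFinP; exact: measurable_funTS.
apply: ge0_subset_integral => //.
by apply/measurable_EFinP; apply: measurableT_comp.
Qed.

End OneDimensional.

Section Slices.
Context {R : realType}.
Implicit Types (h : R3 R -> R).

Definition i0 : 'I_3 := @Ordinal 3 0 isT.
Definition i1 : 'I_3 := @Ordinal 3 1 isT.
Definition i2 : 'I_3 := @Ordinal 3 2 isT.

Lemma sum3 (V : zmodType) (F : 'I_3 -> V) : \sum_(i < 3) F i = F i0 + F i1 + F i2.
Proof.
rewrite !big_ord_recl big_ord0 addr0 addrA.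
by congr (F _ + F _ + F _); exact: val_inj.
Qed.

Lemma all3 (P : 'I_3 -> Prop) : P i0 -> P i1 -> P i2 -> forall i, P i.
Proof.
move=> P0 P1 P2 i; case: i => [[|[|[|//]]] Hi].
- by rewrite (_ : Ordinal _ = i0)//; exact: val_inj.
- by rewrite (_ : Ordinal _ = i1)//; exact: val_inj.
- by rewrite (_ : Ordinal _ = i2)//; exact: val_inj.
Qed.

Lemma is_derive_slice0 h (y z t : R) : derivable h (t, y, z) (unit_vec i0) ->
  is_derive t 1 (fun s => h (s, y, z)) (pderiv i0 h (t, y, z)).
Proof.
have E (s : R) : (s, y, z) = s *: unit_vec i0 + (0, y, z) :> R3 R.
  transitivity ((s * 1%:R + 0, s * 0%:R + y, s * 0%:R + z) : R3 R) => //.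
  by rewrite mulr1 !mulr0 !add0r addr0.
move=> /is_derive_pderiv; rewrite E => /is_derive_line.
by under eq_fun do rewrite -E.
Qed.

Lemma is_derive_slice1 h (x z t : R) : derivable h (x, t, z) (unit_vec i1) ->
  is_derive t 1 (fun s => h (x, s, z)) (pderiv i1 h (x, t, z)).
Proof.
have E (s : R) : (x, s, z) = s *: unit_vec i1 + (x, 0, z) :> R3 R.
  transitivity ((s * 0%:R + x, s * 1%:R + 0, s * 0%:R + z) : R3 R) => //.
  by rewrite mulr1 !mulr0 !add0r addr0.
move=> /is_derive_pderiv; rewrite E => /is_derive_line.
by under eq_fun do rewrite -E.
Qed.

Lemma is_derive_slice2 h (x y t : R) : derivable h (x, y, t) (unit_vec i2) ->
  is_derive t 1 (fun s => h (x, y, s)) (pderiv i2 h (x, y, t)).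
Proof.
have E (s : R) : (x, y, s) = s *: unit_vec i2 + (x, y, 0) :> R3 R.
  transitivity ((s * 0%:R + x, s * 0%:R + y, s * 1%:R + 0) : R3 R) => //.
  by rewrite mulr1 !mulr0 !add0r addr0.
move=> /is_derive_pderiv; rewrite E => /is_derive_line.
by under eq_fun do rewrite -E.
Qed.

Lemma continuous_pair (T U V : topologicalType) (f : T -> U) (g : T -> V) :
  continuous f -> continuous g -> continuous (fun x : T => (f x, g x)).
Proof. by move=> cf cg t; apply: cvg_pair; [exact: cf|exact: cg]. Qed.

Lemma continuous_slice0 h (y z : R) : continuous h -> continuous (fun s : R => h (s, y, z)).
Proof.
move=> ch s; apply: (@continuous_comp _ _ _ (fun s : R => (s, y, z)) h); last exact: ch.
apply: continuous_pair; [apply: continuous_pair|]; by move=> ?; try exact: cvg_cst.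
Qed.

Lemma continuous_slice1 h (x z : R) : continuous h -> continuous (fun s : R => h (x, s, z)).
Proof.
move=> ch s; apply: (@continuous_comp _ _ _ (fun s : R => (x, s, z)) h); last exact: ch.
apply: continuous_pair; [apply: continuous_pair|]; by move=> ?; try exact: cvg_cst.
Qed.

Lemma continuous_slice2 h (x y : R) : continuous h -> continuous (fun s : R => h (x, y, s)).
Proof.
move=> ch s; apply: (@continuous_comp _ _ _ (fun s : R => (x, y, s)) h); last exact: ch.
apply: continuous_pair; by move=> ?; try exact: cvg_cst.
Qed.

End Slices.

Section IntegralDerivative.
Context {R : realType}.
Implicit Types (h : R3 R -> R).
Notation mu := (@lebesgue_measure R).
Notation mR := (measurableTypeR R).

Definition lebesgue2 : set (mR * mR)%type -> \bar R := (mu \x mu)%E.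

HB.instance Definition _ := Measure.on lebesgue2.

Definition box2 (M : R) : set (R * R) := `[- M, M]%classic `*` `[- M, M]%classic.

Lemma box2_measurable (M : R) : @measurable _ (mR * mR)%type (box2 M).
Proof. exact: measurableX. Qed.

Lemma box2_finite (M : R) : (lebesgue2 (box2 M) < +oo)%E.
Proof.
by rewrite /lebesgue2 product_measure1E//= !lebesgue_measure_itv/=; case: ifP => _;
  rewrite ?mul0e// -!EFinM ltry.
Qed.

Lemma lebesgue2_sigma_finite : sigma_finite setT lebesgue2.
Proof.
exists (fun n => box2 n%:R) => [|n].
  apply/esym/seteqP; split=> // -[x y] _; exists (Num.bound `|x| + Num.bound `|y|)%N => //.
  have := archi_boundP (normr_ge0 x); have := archi_boundP (normr_ge0 y).
  rewrite /box2 /= !in_itv/= -!ler_norml natrD => hy hx.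
  have := normr_ge0 x; have := normr_ge0 y.
  by move=> x0 y0; split; lra.
by split; [exact: box2_measurable|exact: box2_finite].
Qed.

(* The library's instance for products of sigma-finite measures is shadowed by
   the one for subprobabilities. *)
HB.instance Definition _ :=
  Measure_isSigmaFinite.Build _ _ _ lebesgue2 lebesgue2_sigma_finite.

Lemma Fubini3_z (f : R3 mR -> \bar R) : lebesgue3.-integrable setT f ->
  (\int[lebesgue3]_x f x = \int[mu]_z \int[lebesgue2]_xy f (xy, z))%E.
Proof.
by move=> If; apply/esym; exact: (@integral21_prod_meas1 _ _ _ _ _ lebesgue2 mu f If).
Qed.

Lemma Fubini3_xy (f : R3 mR -> \bar R) : lebesgue3.-integrable setT f ->
  (\int[lebesgue3]_x f x = \int[lebesgue2]_xy \int[mu]_z f (xy, z))%E.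
Proof.
by move=> If; apply/esym; exact: (@integral12_prod_meas1 _ _ _ _ _ lebesgue2 mu f If).
Qed.

Lemma Fubini2_x (f : mR * mR -> \bar R) : lebesgue2.-integrable setT f ->
  (\int[lebesgue2]_x f x = \int[mu]_x \int[mu]_y f (x, y))%E.
Proof.
by move=> If; apply/esym; exact: (@integral12_prod_meas1 _ _ _ _ _ mu mu f If).
Qed.

Lemma Fubini2_y (f : mR * mR -> \bar R) : lebesgue2.-integrable setT f ->
  (\int[lebesgue2]_x f x = \int[mu]_y \int[mu]_x f (x, y))%E.
Proof.
by move=> If; apply/esym; exact: (@integral21_prod_meas1 _ _ _ _ _ mu mu f If).
Qed.

Lemma measurable_slice12 (h : R3 R -> R) (z : R) :
  @measurable_fun _ _ (R3 mR) mR setT h ->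
  @measurable_fun _ _ (mR * mR)%type mR setT (fun xy => h (xy, z)).
Proof. by move=> mh; apply: (measurableT_comp mh); exact: measurable_pair2. Qed.

Lemma csupp_slice_integrable h (z : R) : continuous_csupp h ->
  lebesgue2.-integrable setT (fun xy => (h (xy, z))%:E).
Proof.
move=> hc; have [B B0 hB] := csupp_bounded _ hc.
have [_ [M hM]] := hc.
apply: (bounded_support_integrable _ _ _ lebesgue2 _ (fun xy => h (xy, z)) B
  (box2_measurable M) (box2_finite M) _ (fun xy => hB (xy, z))).
- exact: (measurable_slice12 _ _ (csupp_measurable _ hc)).
- by move=> [x y] nxy; apply: hM => -[].
Qed.

(** Fubini's theorem lets the variable [i] be integrated first, and the integral over a line of the
    derivative of a compactly supported function is zero. *)
Lemma integral_pderiv0 h i : continuous_csupp h -> continuous_csupp (pderiv i h) ->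
  (forall x, derivable h x (unit_vec i)) ->
  (\int[lebesgue3]_x (pderiv i h x)%:E = 0)%E.
Proof.
move=> hc dhc dh; have [ch [M hM]] := hc; have [cdh [N dhN]] := dhc.
pose L := Num.max M N.
have hL x : ~ box L x -> h x = 0.
  case: x => [[x y] z] nb; apply: hM => /boxP[xM yM zM]; apply: nb; apply/boxP.
  by rewrite !le_max xM yM zM.
have dhL x : ~ box L x -> pderiv i h x = 0.
  case: x => [[x y] z] nb; apply: dhN => /boxP[xM yM zM]; apply: nb; apply/boxP.
  by rewrite !le_max xM yM zM !orbT.
have Idh := csupp_integrable _ dhc.
elim/all3: i dhc cdh dhN dh dhL Idh => dhc cdh dhN dh dhL Idh.
- rewrite (Fubini3_z _ Idh); apply: integral0_eq => z _.
  rewrite (Fubini2_y _ (csupp_slice_integrable _ z dhc)).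
  apply: integral0_eq => y _.
  apply: (integral_derive_csupp (fun x => h (x, y, z)) _ L).
  + by move=> t; exact: is_derive_slice0.
  + exact: continuous_slice0.
  + by move=> t Lt; apply: hL => /boxP[]; rewrite leNgt Lt.
  + by move=> t Lt; apply: dhL => /boxP[]; rewrite leNgt Lt.
- rewrite (Fubini3_z _ Idh); apply: integral0_eq => z _.
  rewrite (Fubini2_x _ (csupp_slice_integrable _ z dhc)).
  apply: integral0_eq => x _.
  apply: (integral_derive_csupp (fun y => h (x, y, z)) _ L).
  + by move=> t; exact: is_derive_slice1.
  + exact: continuous_slice1.
  + by move=> t Lt; apply: hL => /boxP[_]; rewrite leNgt Lt.
  + by move=> t Lt; apply: dhL => /boxP[_]; rewrite leNgt Lt.
- rewrite (Fubini3_xy _ Idh); apply: integral0_eq => -[x y] _.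
  apply: (integral_derive_csupp (fun z => h (x, y, z)) _ L).
  + by move=> t; exact: is_derive_slice2.
  + exact: continuous_slice2.
  + by move=> t Lt; apply: hL => /boxP[_ _]; rewrite leNgt Lt.
  + by move=> t Lt; apply: dhL => /boxP[_ _]; rewrite leNgt Lt.
Qed.

End IntegralDerivative.

(** * The space L2 *)

Set Implicit Arguments.
Unset Strict Implicit.
Unset Printing Implicit Defensive.

Section L2Space.
Context {R : realType}.
Variable D : set (R3 R).
Hypothesis oD : open D.
Implicit Types (f g h : R3 R -> R) (c : R).
Notation mR3 := (R3 (measurableTypeR R)).
Notation mu3 := (@lebesgue3 R).

Let mD : @measurable _ mR3 D := open_measurable3 _ oD.

Definition ip f g : R := \int[lebesgue3]_(x in D) (f x * g x).
Definition nrm f : R := fine (L2norm D f).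

Lemma L2_measurable f : L2 D f ->
  @measurable_fun _ _ mR3 (measurableTypeR R) D f.
Proof.
by rewrite /L2 inE => /andP[/[!inE]/= mf _]; exact: (measurable_restrictT _ mD).2.
Qed.

Lemma L2P f : L2 D f <-> @measurable_fun _ _ mR3 (measurableTypeR R) D f /\
  mu3.-integrable D (EFin \o (fun x => f x ^+ 2)).
Proof.
have E : (EFin \o (fun x => f x ^+ 2)) \_ D = EFin \o (fun x => (f \_ D) x ^+ 2).
  by apply/funext => x; rewrite /= !patchE; case: ifP => //; rewrite expr0n.
split=> [Lf|[mf If]].
  split; first exact: L2_measurable.
  apply: (iffRL (integrable_mkcond _ mD)).
  by rewrite E; apply: Lfun2_integrable_sqr.
rewrite /L2 inE; apply/andP; split; rewrite inE/=.
  exact: (measurable_restrictT _ mD).1.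
rewrite /finite_norm unlock; apply: poweR_lty.
have /integrableP[_] := iffLR (integrable_mkcond _ mD) If.
rewrite E; apply: le_lt_trans; rewrite le_eqVlt; apply/orP; left; apply/eqP.
apply: eq_integral => x _ /=.
by rewrite powR_mulrn// normrX.
Qed.

Lemma L2norm_fin f : L2 D f -> L2norm D f = (nrm f)%:E.
Proof.
move=> Lf; rewrite /nrm fineK// ge0_fin_numE ?Lnorm_ge0//.
by move: Lf; rewrite /L2 inE => /andP[_]; rewrite inE.
Qed.

Lemma nrm_ge0 f : 0 <= nrm f.
Proof. by rewrite fine_ge0// Lnorm_ge0. Qed.

Lemma ipE f g : ip f g = \int[mu3]_x ((f \_ D) x * (g \_ D) x).
Proof.
rewrite /ip Rintegral_mkcond; apply: eq_Rintegral => x _.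
by rewrite !patchE; case: ifP => //; rewrite mulr0.
Qed.

Lemma L2_mul_integrable f g : L2 D f -> L2 D g ->
  mu3.-integrable D (EFin \o (fun x => f x * g x)).
Proof.
move=> Lf Lg; apply: (iffRL (integrable_mkcond _ mD)).
have -> : (EFin \o (fun x => f x * g x)) \_ D = EFin \o (f \_ D \* g \_ D).
  by apply/funext => x; rewrite /= !patchE; case: ifP => //; rewrite mulr0.
by apply/Lfun1_integrable; exact: Lfun2_mul_Lfun1.
Qed.

Lemma nrm_sq f : L2 D f -> nrm f ^+ 2 = ip f f.
Proof.
move=> Lf; have := @poweR_Lnorm _ _ _ mu3 (EFin \o f \_ D) 2 (lt0r_neq0 (ltr0Sn R 1)).
rewrite -/(L2norm D f) (L2norm_fin Lf) poweR_EFin powR_mulrn ?nrm_ge0// => E.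
rewrite ipE /Rintegral.
have -> : (\int[mu3]_x ((f \_ D) x * (f \_ D) x)%:E =
    \int[mu3]_x (`|(EFin \o f \_ D) x| `^ 2))%E.
  apply: eq_integral => x _ /=.
  by rewrite powR_mulrn// -normrX expr2 ger0_norm// -expr2 sqr_ge0.
by rewrite -E.
Qed.

Lemma ip_cs f g : L2 D f -> L2 D g -> `|ip f g| <= nrm f * nrm g.
Proof.
move=> Lf Lg.
have If := (iffLR (integrable_mkcond _ mD) (L2_mul_integrable Lf Lg)).
rewrite /ip (le_trans (le_normr_Rintegral mD (L2_mul_integrable Lf Lg)))//.
have mf := (measurable_restrictT _ mD).1 (L2_measurable Lf).
have mg := (measurable_restrictT _ mD).1 (L2_measurable Lg).
have := @hoelder _ _ _ mu3 _ _ 2 2 mf mg (ltr0Sn R 1) (ltr0Sn R 1).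
rewrite -/(L2norm D f) -/(L2norm D g) (L2norm_fin Lf) (L2norm_fin Lg) Lnorm1.
have -> : (\int[mu3]_x `|(EFin \o (f \_ D \* g \_ D)%R) x| =
  \int[mu3]_(x in D) `|f x * g x|%R%:E)%E.
  rewrite [RHS]integral_mkcond; apply: eq_integral => x _ /=.
  by rewrite !patchE; case: ifP => //; rewrite mulr0 normr0.
move=> H; rewrite -lee_fin; apply: le_trans (H _); last by rewrite [RHS]splitr !div1r.
rewrite /Rintegral fineK//; apply: integrable_fin_num => //.
have := integrable_norm (L2_mul_integrable Lf Lg); apply: eq_integrable => //.
Qed.

Lemma L2D f g : L2 D f -> L2 D g -> L2 D (f \+ g).
Proof.
rewrite /L2 => Lf Lg.
have -> : (f \+ g) \_ D = f \_ D + g \_ D.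
  by apply/funext => x; rewrite /= fctE !patchE; case: ifP => //; rewrite addr0.
by apply: (Lfun_addr_closed mu3 _).2 => //; rewrite lee_fin ler1n.
Qed.

Lemma L2N f : L2 D f -> L2 D (\- f).
Proof.
rewrite /L2 => Lf.
have -> : (\- f) \_ D = - (f \_ D).
  by apply/funext => x; rewrite /= fctE !patchE; case: ifP => //; rewrite oppr0.
by apply: Lfun_oppr_closed => //; rewrite lee_fin ler1n.
Qed.

Lemma L2B f g : L2 D f -> L2 D g -> L2 D (f \- g).
Proof. by move=> Lf /L2N; exact: L2D. Qed.

Lemma ipC f g : ip f g = ip g f.
Proof. by rewrite /ip; apply: eq_Rintegral => x _; rewrite mulrC. Qed.

Lemma ipDl f g h : L2 D f -> L2 D g -> L2 D h -> ip (f \+ g) h = ip f h + ip g h.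
Proof.
move=> Lf Lg Lh; rewrite /ip -RintegralD//; try exact: L2_mul_integrable.
by apply: eq_Rintegral => x _ /=; rewrite mulrDl.
Qed.

Lemma ipBl f g h : L2 D f -> L2 D g -> L2 D h -> ip (f \- g) h = ip f h - ip g h.
Proof.
move=> Lf Lg Lh; rewrite /ip -RintegralB//; try exact: L2_mul_integrable.
by apply: eq_Rintegral => x _ /=; rewrite mulrBl.
Qed.

Lemma ipBr f g h : L2 D f -> L2 D g -> L2 D h -> ip h (f \- g) = ip h f - ip h g.
Proof. by move=> Lf Lg Lh; rewrite ipC ipBl// !(ipC _ h). Qed.

Lemma L2_dominated c f g : @measurable_fun _ _ mR3 (measurableTypeR R) D f ->
  (forall x, D x -> `|f x| <= c * `|g x|) -> L2 D g -> L2 D f.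
Proof.
move=> mf fg /L2P[mg Ig]; apply/L2P; split => //.
have Icg : mu3.-integrable D (EFin \o (fun x => c ^+ 2 * g x ^+ 2)).
  exact: (integrableZl mD (c ^+ 2) Ig).
apply: le_integrable Icg => //.
  by apply/measurable_EFinP; exact: measurable_funX.
move=> x Dx; rewrite /= lee_fin normrX -exprMn -[leRHS]ger0_norm ?sqr_ge0//.
rewrite !normrX !normrM.
rewrite lerXn2r ?nnegrE// ?mulr_ge0// (le_trans (fg x Dx))//.
by rewrite !normr_id ler_wpM2r// ler_norm.
Qed.

Lemma nrm_le c f g : 0 <= c -> L2 D f -> L2 D g ->
  (forall x, D x -> `|f x| <= c * `|g x|) -> nrm f <= c * nrm g.
Proof.
move=> c0 Lf Lg fg.
rewrite -(@ler_pXn2r _ 2) ?nnegrE ?mulr_ge0 ?nrm_ge0// exprMn !nrm_sq//.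
rewrite /ip -RintegralZl//; last exact: L2_mul_integrable.
have Igg := L2_mul_integrable Lg Lg.
apply: le_Rintegral => //; first exact: L2_mul_integrable.
  by apply: (@integrableZl _ _ _ mu3 D mD (c^+2) _ Igg).
move=> x Dx; rewrite -!expr2 -exprMn -[_ ^+ 2]ger0_norm ?sqr_ge0//.
rewrite -[leRHS]ger0_norm ?sqr_ge0// !normrX lerXn2r ?nnegrE//.
by rewrite normrM (ger0_norm c0) fg.
Qed.

Lemma nrm_triangle f g : L2 D f -> L2 D g -> nrm (f \+ g) <= nrm f + nrm g.
Proof.
move=> Lf Lg; have Lfg := L2D Lf Lg.
rewrite -(@ler_pXn2r _ 2) ?nnegrE ?addr_ge0 ?nrm_ge0// sqrrD !nrm_sq//.
rewrite ipDl// (ipC f) (ipC g) !ipDl// (ipC g f).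
have := ip_cs Lf Lg; have := ler_norm (ip f g); lra.
Qed.

Lemma eq_ip f f' g g' : {in D, f =1 f'} -> {in D, g =1 g'} -> ip f g = ip f' g'.
Proof. by move=> ff' gg'; apply: eq_Rintegral => x Dx; rewrite ff'// gg'. Qed.

Lemma nrm_cvg0 (f_ : nat -> R3 R -> R) :
  L2norm D (f_ n) @[n --> \oo] --> 0%E -> nrm (f_ n) @[n --> \oo] --> 0.
Proof. exact: fine_cvg. Qed.

Lemma ip_cvg (f_ g_ : nat -> R3 R -> R) f g :
  (forall n, L2 D (f_ n)) -> (forall n, L2 D (g_ n)) -> L2 D f -> L2 D g ->
  nrm (f_ n \- f) @[n --> \oo] --> 0 -> nrm (g_ n \- g) @[n --> \oo] --> 0 ->
  ip (f_ n) (g_ n) @[n --> \oo] --> ip f g.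
Proof.
move=> Lf_ Lg_ Lf Lg cf cg.
have E n : ip (f_ n) (g_ n) =
    ip f g + (ip (f_ n \- f) (g_ n \- g) + ip (f_ n \- f) g + ip f (g_ n \- g)).
  have Lfn := L2B (Lf_ n) Lf; have Lgn := L2B (Lg_ n) Lg.
  by rewrite ipBr// !ipBl// ipBr//; lra.
under eq_fun do rewrite E.
have key (a : nat -> R) (b : nat -> R) :
    (forall n, `|a n| <= b n) -> b n @[n --> \oo] --> 0 -> a n @[n --> \oo] --> 0.
  move=> ab b0; apply/norm_cvg0P; apply: (squeeze_cvgr _ (cvg_cst 0) b0).
  by apply: nearW => n; rewrite normr_ge0 ab.
have c1 : ip (f_ n \- f) (g_ n \- g) @[n --> \oo] --> 0.
  apply: (key _ (fun n => nrm (f_ n \- f) * nrm (g_ n \- g))).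
    by move=> n; apply: ip_cs; exact: L2B.
  by have := cvgM cf cg; rewrite mulr0; exact.
have c2 : ip (f_ n \- f) g @[n --> \oo] --> 0.
  apply: (key _ (fun n => nrm (f_ n \- f) * nrm g)).
    by move=> n; apply: ip_cs => //; exact: L2B.
  by have := cvgM cf (cvg_cst (nrm g)); rewrite mul0r; exact.
have c3 : ip f (g_ n \- g) @[n --> \oo] --> 0.
  apply: (key _ (fun n => nrm f * nrm (g_ n \- g))).
    by move=> n; apply: ip_cs => //; exact: L2B.
  by have := cvgM (cvg_cst (nrm f)) cg; rewrite mulr0; exact.
have := cvgD (cvg_cst (ip f g)) (cvgD (cvgD c1 c2) c3).
by rewrite !addr0; exact.
Qed.

Lemma L2_csupp h : continuous_csupp h -> L2 D h.
Proof.
move=> hc; apply/L2P; split; first exact: measurable_funTS (csupp_measurable _ hc).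
apply: (integrableS measurableT mD (@subsetT _ D)).
have := csupp_integrable _ (csupp_mul _ _ hc.1 hc).
by apply: eq_integrable => // x _ /=; rewrite expr2.
Qed.

Lemma test_csupp f : test_function D f -> continuous_csupp f.
Proof.
move=> [sf cf _]; apply: csupp_closure_compact cf.
by move=> x; exact: smooth_continuous sf I.
Qed.

Lemma L2_test f : test_function D f -> L2 D f.
Proof. by move=> tf; exact/L2_csupp/test_csupp. Qed.

Lemma test_bounded f : test_function D f -> exists2 B : R, 0 <= B & forall x, `|f x| <= B.
Proof. by move=> tf; exact/csupp_bounded/test_csupp. Qed.

Lemma Rintegral_pderiv_test f i : test_function D f ->
  \int[lebesgue3]_(x in D) pderiv i f x = 0.
Proof.
move=> tf; have tdf := test_pderiv _ _ i tf.
rewrite Rintegral_mkcond.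
have -> : pderiv i f \_ D = pderiv i f.
  apply/funext => x; rewrite patchE; case: ifPn => // /negP.
  by rewrite inE => /(test_outside _ _ _ tdf) ->.
rewrite /Rintegral (integral_pderiv0 _ i (test_csupp tf) (test_csupp tdf))//.
by move=> x; have [sf _ _] := tf; exact: smooth_derivable sf I.
Qed.

Lemma continuous_mul_test_csupp f phi : (forall x, D x -> {for x, continuous f}) ->
  test_function D phi -> continuous_csupp (f \* phi).
Proof.
move=> cf tphi; split; first exact: continuous_mul_test cf tphi.
have [_ [M hM]] := test_csupp tphi.
by exists M => x /hM /= ->; rewrite mulr0.
Qed.

Lemma smooth_mul_test_integrable f phi : smooth_on D f -> test_function D phi ->
  mu3.-integrable D (EFin \o (fun x => f x * phi x)).
Proof.
move=> sf tphi; apply: (integrableS measurableT mD (@subsetT _ D)) => //.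
apply: csupp_integrable; apply: continuous_mul_test_csupp tphi => x.
exact: smooth_continuous sf.
Qed.

(** No growth condition on [f] enters and no boundary term appears: f phi is itself a test function,
    so the integral of its derivative vanishes. *)
Lemma ip_pderiv_test f phi i : smooth_on D f -> test_function D phi ->
  ip (pderiv i f) phi = - ip f (pderiv i phi).
Proof.
move=> sf tphi; have := Rintegral_pderiv_test i (test_mul _ _ _ oD sf tphi).
have tdphi := test_pderiv _ _ i tphi.
have -> : \int[lebesgue3]_(x in D) pderiv i (f \* phi) x =
    \int[lebesgue3]_(x in D) (pderiv i f x * phi x + f x * pderiv i phi x).
  apply: eq_Rintegral => x /[!inE] Dx.
  by rewrite (pderivM _ _ _ _ _ sf (test_smooth _ _ D tphi) Dx).
rewrite RintegralD//; [|exact: smooth_mul_test_integrable (smooth_pderiv _ _ _ sf) tphi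
  |exact: smooth_mul_test_integrable].
by move/eqP; rewrite addr_eq0 => /eqP.
Qed.

End L2Space.

(** * Ladyzhenskaya's inequality *)

(** The measure is arbitrary because the inequality is applied on horizontal slices, under
    [lebesgue2]. *)
Lemma Rintegral_cauchy_schwarz d (T : measurableType d) (R : realType)
    (mu : {measure set T -> \bar R}) (f g : T -> R) :
  measurable_fun setT f -> measurable_fun setT g ->
  mu.-integrable setT (EFin \o (fun x => f x ^+ 2)) ->
  mu.-integrable setT (EFin \o (fun x => g x ^+ 2)) ->
  (\int[mu]_x `|f x * g x|) ^+ 2 <= (\int[mu]_x f x ^+ 2) * (\int[mu]_x g x ^+ 2).
Proof.
move=> mf mg If Ig.
have N2 (h : T -> R) : mu.-integrable setT (EFin \o (fun x => h x ^+ 2)) ->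
    exists n : R, [/\ 0 <= n, ('N[mu]_2%:E[EFin \o h] = n%:E)%E &
      n ^+ 2 = \int[mu]_x h x ^+ 2].
  move=> Ih.
  have := @poweR_Lnorm _ _ _ mu (EFin \o h) 2 (lt0r_neq0 (ltr0Sn R 1)).
  have -> : (\int[mu]_x (`|(EFin \o h) x| `^ 2) = (\int[mu]_x (h x ^+ 2))%:E)%E.
    rewrite /Rintegral fineK; last exact: integrable_fin_num.
    apply: eq_integral => x _ /=.
    by rewrite powR_mulrn// -normrX ger0_norm// sqr_ge0.
  have := Lnorm_ge0 mu 2%:E (EFin \o h).
  case: ('N[mu]_2%:E[EFin \o h])%E => [n|_|//].
    rewrite lee_fin => n0; rewrite poweR_EFin powR_mulrn// => -[<-].
    by exists n.
  by rewrite poweRE gt_eqF.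
have [n [n0 nE <-]] := N2 _ If; have [m [m0 mE <-]] := N2 _ Ig.
have := @hoelder _ _ _ mu _ _ 2 2 mf mg (ltr0Sn R 1) (ltr0Sn R 1).
rewrite nE mE Lnorm1 => /(_ _)/wrap[]; first by rewrite [RHS]splitr !div1r.
move=> H.
rewrite -exprMn ler_pXn2r ?nnegrE ?mulr_ge0//; last exact: Rintegral_ge0.
rewrite -lee_fin /Rintegral fineK//.
by rewrite ge0_fin_numE ?integral_ge0// (le_lt_trans H) ?ltry.
Qed.

Section Ladyzhenskaya.
Context {R : realType}.
Notation mu := (@lebesgue_measure R).
Notation mR := (measurableTypeR R).
Notation mR2 := (mR * mR)%type.

(** Gagliardo's device: one factor of k^2 is bounded by a function of y alone and the other by a
    function of x alone, and the integral of such a product factors. By Tonelli's theorem this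
    remains true when some of the values are infinite. *)
Lemma integral_sq_le_product (k f0 f1 : R * R -> R) :
  @measurable_fun _ _ mR2 mR setT k -> @measurable_fun _ _ mR2 mR setT f0 ->
  @measurable_fun _ _ mR2 mR setT f1 ->
  (forall x, 0 <= f0 x) -> (forall x, 0 <= f1 x) ->
  (forall x y, (`|k (x, y)|%:E <= \int[mu]_s (f0 (s, y))%:E)%E) ->
  (forall x y, (`|k (x, y)|%:E <= \int[mu]_s (f1 (x, s))%:E)%E) ->
  (\int[lebesgue2]_x (k x ^+ 2)%:E <=
    (\int[lebesgue2]_x (f0 x)%:E) * (\int[lebesgue2]_x (f1 x)%:E))%E.
Proof.
move=> mk mf0 mf1 f00 f10 kf0 kf1.
pose G y := (\int[mu]_s (f0 (s, y))%:E)%E.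
pose H x := (\int[mu]_s (f1 (x, s))%:E)%E.
have G0 y : (0 <= G y)%E by apply: integral_ge0 => s _; rewrite lee_fin.
have H0 x : (0 <= H x)%E by apply: integral_ge0 => s _; rewrite lee_fin.
have mef0 : @measurable_fun _ _ mR2 _ setT (EFin \o f0) by exact/measurable_EFinP.
have mef1 : @measurable_fun _ _ mR2 _ setT (EFin \o f1) by exact/measurable_EFinP.
have mG : @measurable_fun _ _ mR _ setT G.
  by apply: (measurable_fun_fubini_tonelli_G (m1 := mu) _ mef0) => x; rewrite lee_fin.
have mH : @measurable_fun _ _ mR _ setT H.
  by apply: (measurable_fun_fubini_tonelli_F (m2 := mu) _ mef1) => x; rewrite lee_fin.
have mGH : @measurable_fun _ _ mR2 _ setT (fun xy : mR2 => H xy.1 * G xy.2)%E.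
  apply: emeasurable_funM.
    exact: (measurableT_comp mH measurable_fst).
  exact: (measurableT_comp mG measurable_snd).
apply: (@le_trans _ _ (\int[lebesgue2]_xy (H xy.1 * G xy.2))%E).
  apply: ge0_le_integral => //=.
  - by move=> x _; rewrite lee_fin sqr_ge0.
  - by apply/measurable_EFinP; exact: measurable_funX.
  - move=> [x y] _ /=.
    rewrite -[_ ^+ 2]ger0_norm ?sqr_ge0// normrX expr2 EFinM.
    by apply: lee_pmul; rewrite ?lee_fin.
rewrite (_ : (\int[lebesgue2]_xy (H xy.1 * G xy.2) =
    \int[mu]_x \int[mu]_y (H x * G y))%E); last first.
  apply: (@fubini_tonelli1 _ _ _ _ _ mu mu _ mGH) => -[x y].
  exact: mule_ge0.
under eq_integral => x _ do rewrite ge0_integralZl//.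
rewrite ge0_integralZr//; last exact: integral_ge0.
rewrite muleC.
rewrite (_ : (\int[lebesgue2]_x (f0 x)%:E = \int[mu]_y G y)%E); last first.
  by apply: (@fubini_tonelli2 _ _ _ _ _ mu mu _ mef0) => x; rewrite lee_fin.
rewrite (_ : (\int[lebesgue2]_x (f1 x)%:E = \int[mu]_x H x)%E) //.
by apply: (@fubini_tonelli1 _ _ _ _ _ mu mu _ mef1) => x; rewrite lee_fin.
Qed.

Lemma csupp_norm (h : R3 R -> R) : continuous_csupp h ->
  continuous_csupp (fun x => `|h x|).
Proof.
move=> [ch [M hM]]; split; last by exists M => x /hM ->; rewrite normr0.
by move=> x; apply: continuous_comp; [exact: ch|exact: norm_continuous].
Qed.

Lemma csupp_scale (c : R) (h : R3 R -> R) : continuous_csupp h ->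
  continuous_csupp (fun x => c * h x).
Proof. by move=> hc; apply: (csupp_mul (cst c)) hc => x; exact: cvg_cst. Qed.

Lemma csupp_sqr (h : R3 R -> R) : continuous_csupp h ->
  continuous_csupp (fun x => h x ^+ 2).
Proof. by move=> hc; apply: csupp_mul => //; exact: hc.1. Qed.

Lemma slice_integral_EFin (h : R3 R -> R) (z : R) : continuous_csupp h ->
  (\int[lebesgue2]_xy (h (xy, z))%:E = (\int[lebesgue2]_xy h (xy, z))%:E)%E.
Proof.
move=> hc; rewrite /Rintegral fineK//; apply: integrable_fin_num => //.
exact: csupp_slice_integrable.
Qed.

Lemma csupp_integral_EFin (h : R3 R -> R) : continuous_csupp h ->
  (\int[lebesgue3]_x (h x)%:E = (\int[lebesgue3]_x h x)%:E)%E.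
Proof.
move=> hc; rewrite /Rintegral fineK//; apply: integrable_fin_num => //.
exact: csupp_integrable.
Qed.

(** The planar inequality is applied to k = h^2 on each horizontal slice. It bounds the integral of
    k^2 by the product of those of |d_x k| and |d_y k|, and by Cauchy-Schwarz each of these is at
    most twice the norm of h times that of its derivative on the slice. The mass of h^2 on a slice
    is bounded uniformly in z by the integral of |d_z k| over the whole space, so that integration
    in z leaves only quadratic quantities. *)
Lemma ladyzhenskaya (h : R3 R -> R) : continuous_csupp h ->
  (forall i, continuous_csupp (pderiv i h)) ->
  (forall i x, derivable h x (unit_vec i)) ->
  \int[lebesgue3]_x ((h x ^+ 2) ^+ 2) <=
  2 * (\int[lebesgue3]_x (h x ^+ 2) + \int[lebesgue3]_x (pderiv i2 h x ^+ 2)) *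
    (\int[lebesgue3]_x (pderiv i0 h x ^+ 2) +
     \int[lebesgue3]_x (pderiv i1 h x ^+ 2)).
Proof.
move=> hc dhc dh.
pose k x := h x ^+ 2; pose dk i x := 2 * (h x * pderiv i h x).
have kc : continuous_csupp k by exact: csupp_sqr.
have dkc i : continuous_csupp (dk i).
  by apply/csupp_scale; exact: csupp_mul _ _ hc.1 (dhc i).
have dkE i x : is_derive x (unit_vec i) k (dk i x).
  have := @is_deriveM _ _ _ _ _ _ _ _ (is_derive_pderiv _ _ _ (dh i x))
    (is_derive_pderiv _ _ _ (dh i x)).
  have -> : k = h * h by apply/funext => y; rewrite /k expr2.
  by move=> H; apply: (is_derive_eq H); rewrite /dk /GRing.scale/=; lra.
have kd i x : derivable k x (unit_vec i) by have [] := dkE i x.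
have kE i : pderiv i k = dk i by apply/funext => x; rewrite /pderiv; have [_ ->] := dkE i x.
(* To be read with x = [A i0 z], y = [A i1 z], u = [a z]: then x y <= (x^2 + y^2) / 2 <= 2 u (c0 +
   c1) <= 2 K (c0 + c1). *)
have prod_le (x y u c0 c1 K : R) : u * (c0 + c1) <= K * (c0 + c1) ->
    0 <= (x - y) ^+ 2 -> y ^+ 2 <= 4 * (u * c1) -> x ^+ 2 <= 4 * (u * c0) ->
    forall v, v <= x * y -> v <= 2 * K * (c0 + c1).
  by move=> h1 h2 h3 h4 v h5; nra.
have amgm (x y s t : R) : 0 <= s - x * y *+ 2 + t -> 2 * (x * y) <= s + t by lra.
pose K := \int[lebesgue3]_x `|dk i2 x|.
have [_ [M kM]] := kc.
have kM0 x y z t : M < `|t| -> [/\ k (t, y, z) = 0, k (x, t, z) = 0 & k (x, y, t) = 0].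
  by move=> Mt; split; apply: kM => /boxP[]; rewrite ?(leNgt `|t|) Mt.
have b0 x y z : (`|k (x, y, z)|%:E <= \int[mu]_s `|dk i0 (s, y, z)|%:E)%E.
  apply: (@le_integral_derive_csupp _ (fun s => k (s, y, z)) (fun s => dk i0 (s, y, z)) M).
  - by move=> t; rewrite -kE; exact: is_derive_slice0.
  - by apply: continuous_slice0; exact: (dkc i0).1.
  - by move=> t /(kM0 0 y z)[].
have b1 x y z : (`|k (x, y, z)|%:E <= \int[mu]_s `|dk i1 (x, s, z)|%:E)%E.
  apply: (@le_integral_derive_csupp _ (fun s => k (x, s, z)) (fun s => dk i1 (x, s, z)) M).
  - by move=> t; rewrite -kE; exact: is_derive_slice1.
  - by apply: continuous_slice1; exact: (dkc i1).1.
  - by move=> t /(kM0 x 0 z)[].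
have b2 x y z : (`|k (x, y, z)|%:E <= \int[mu]_s `|dk i2 (x, y, s)|%:E)%E.
  apply: (@le_integral_derive_csupp _ (fun s => k (x, y, s)) (fun s => dk i2 (x, y, s)) M).
  - by move=> t; rewrite -kE; exact: is_derive_slice2.
  - by apply: continuous_slice2; exact: (dkc i2).1.
  - by move=> t /(kM0 x y 0)[].
pose a z := \int[lebesgue2]_xy k (xy, z).
pose c i z := \int[lebesgue2]_xy (pderiv i h (xy, z) ^+ 2).
pose A i z := \int[lebesgue2]_xy `|dk i (xy, z)|.
have m2 (g : R3 R -> R) z : continuous_csupp g ->
    @measurable_fun _ _ mR2 mR setT (fun xy => g (xy, z)).
  by move=> gc; apply: measurable_slice12; exact: csupp_measurable.
have k_ge0 x : 0 <= k x by exact: sqr_ge0.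
(* Integrating the one-dimensional bound [b2] over (x, y) gives a bound that no longer depends on
   z. *)
have aK z : a z <= K.
  rewrite -lee_fin -slice_integral_EFin// -csupp_integral_EFin; last exact: csupp_norm.
  rewrite Fubini3_xy; last exact: (csupp_integrable _ (csupp_norm (dkc i2))).
  apply: ge0_le_integral => //=.
  - by move=> x _; rewrite lee_fin.
  - by apply/measurable_EFinP; exact: m2.
  - have mdk : @measurable_fun _ _ (R3 mR) _ setT (EFin \o (fun x => `|dk i2 x|)).
      by apply/measurable_EFinP; exact: (csupp_measurable _ (csupp_norm (dkc i2))).
    apply: (measurable_fun_fubini_tonelli_F (m2 := mu) _ mdk) => x.
    by rewrite lee_fin.
  - move=> [x y] _ /=; apply: le_trans (b2 x y z).
    by rewrite lee_fin ler_norm.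
have cs i z : A i z ^+ 2 <= 4 * (a z * c i z).
  have : (\int[lebesgue2]_xy `|h (xy, z) * pderiv i h (xy, z)|) ^+ 2 <= a z * c i z.
    apply: Rintegral_cauchy_schwarz; [exact: m2|exact: m2| |].
      exact: (csupp_slice_integrable _ z (csupp_sqr hc)).
    exact: (csupp_slice_integrable _ z (csupp_sqr (dhc i))).
  have -> : A i z = 2 * (\int[lebesgue2]_xy `|h (xy, z) * pderiv i h (xy, z)|).
    rewrite -RintegralZl//; last first.
      exact: (csupp_slice_integrable _ z (csupp_norm (csupp_mul _ _ hc.1 (dhc i)))).
    by apply: eq_Rintegral => xy _; rewrite /dk normrM gtr0_norm.
  by rewrite exprMn -natrX ler_pM2l.
have a0 z : 0 <= a z by exact: Rintegral_ge0.
have c0 i z : 0 <= c i z by apply: Rintegral_ge0 => x _; exact: sqr_ge0.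
have slice z : \int[lebesgue2]_xy (k (xy, z) ^+ 2) <= 2 * K * (c i0 z + c i1 z).
  have : \int[lebesgue2]_xy (k (xy, z) ^+ 2) <= A i0 z * A i1 z.
    have EA i : ((A i z)%:E = \int[lebesgue2]_xy `|dk i (xy, z)|%R%:E)%E :=
      esym (slice_integral_EFin z (csupp_norm (dkc i))).
    rewrite -lee_fin EFinM -[X in (X <= _)%E](slice_integral_EFin z (csupp_sqr kc)).
    rewrite [X in (_ <= X * _)%E]EA [X in (_ <= _ * X)%E]EA.
    apply: (@integral_sq_le_product (fun xy => k (xy, z))
      (fun xy => `|dk i0 (xy, z)|) (fun xy => `|dk i1 (xy, z)|)
      (m2 _ _ kc) (m2 _ _ (csupp_norm (dkc i0))) (m2 _ _ (csupp_norm (dkc i1)))).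
    - by move=> xy; exact: normr_ge0.
    - by move=> xy; exact: normr_ge0.
    - by move=> x y; exact: b0.
    - by move=> x y; exact: b1.
  have := cs i0 z; have := cs i1 z; have := sqr_ge0 (A i0 z - A i1 z).
  have : a z * (c i0 z + c i1 z) <= K * (c i0 z + c i1 z).
    by rewrite ler_wpM2r ?addr_ge0.
  by move=> h1 h2 h3 h4 h5; exact: (prod_le _ _ _ _ _ _ h1 h2 h3 h4 _ h5).
have K_le : K <= \int[lebesgue3]_x (h x ^+ 2) + \int[lebesgue3]_x (pderiv i2 h x ^+ 2).
  rewrite -RintegralD//; last 2 first.
  - exact: (csupp_integrable _ (csupp_sqr hc)).
  - exact: (csupp_integrable _ (csupp_sqr (dhc i2))).
  apply: le_Rintegral => //.
  - exact: (csupp_integrable _ (csupp_norm (dkc i2))).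
  - exact: (csupp_integrable _ (csupp_add _ _ (csupp_sqr hc) (csupp_sqr (dhc i2)))).
  move=> x _; rewrite /dk normrM gtr0_norm// normrM.
  have := sqr_ge0 (`|h x| - `|pderiv i2 h x|).
  by rewrite sqrrB -!normrX !(ger0_norm (sqr_ge0 _)); exact: amgm.
pose S x := 2 * K * (pderiv i0 h x ^+ 2 + pderiv i1 h x ^+ 2).
have Sc : continuous_csupp S.
  by apply/csupp_scale; exact: csupp_add _ _ (csupp_sqr (dhc i0)) (csupp_sqr (dhc i1)).
have S_ge0 x : 0 <= S x.
  rewrite /S mulr_ge0// ?mulr_ge0// ?addr_ge0 ?sqr_ge0//.
  exact: Rintegral_ge0.
have : \int[lebesgue3]_x (k x ^+ 2) <= \int[lebesgue3]_x (S x).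
  rewrite -lee_fin -[X in (X <= _)%E](csupp_integral_EFin (csupp_sqr kc)).
  rewrite -[X in (_ <= X)%E](csupp_integral_EFin Sc).
  rewrite [X in (X <= _)%E](Fubini3_z _ (csupp_integrable _ (csupp_sqr kc))).
  rewrite [X in (_ <= X)%E](Fubini3_z _ (csupp_integrable _ Sc)).
  apply: ge0_le_integral => //=.
  - by move=> z _; apply: integral_ge0 => x _; rewrite lee_fin sqr_ge0.
  - have mk : @measurable_fun _ _ (R3 mR) _ setT (EFin \o (fun x => k x ^+ 2)).
      by apply/measurable_EFinP; exact: (csupp_measurable _ (csupp_sqr kc)).
    apply: (measurable_fun_fubini_tonelli_G (m1 := lebesgue2) _ mk) => x.
    by rewrite lee_fin sqr_ge0.
  - have mk : @measurable_fun _ _ (R3 mR) _ setT (EFin \o S).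
      by apply/measurable_EFinP; exact: csupp_measurable.
    apply: (measurable_fun_fubini_tonelli_G (m1 := lebesgue2) _ mk) => x.
    by rewrite lee_fin.
  - move=> z _; rewrite [X in (X <= _)%E](slice_integral_EFin z (csupp_sqr kc)).
    rewrite [X in (_ <= X)%E](slice_integral_EFin z Sc).
    rewrite lee_fin (le_trans (slice z))//.
    rewrite /S RintegralZl//; last first.
      exact: (csupp_slice_integrable _ z (csupp_add _ _ (csupp_sqr (dhc i0)) (csupp_sqr (dhc i1)))).
    rewrite RintegralD//.
    - exact: (csupp_slice_integrable _ z (csupp_sqr (dhc i0))).
    - exact: (csupp_slice_integrable _ z (csupp_sqr (dhc i1))).
have -> : \int[lebesgue3]_x (S x) = 2 * K * (\int[lebesgue3]_x (pderiv i0 h x ^+ 2) +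
     \int[lebesgue3]_x (pderiv i1 h x ^+ 2)).
  rewrite /S RintegralZl//; last first.
    exact: (csupp_integrable _ (csupp_add _ _ (csupp_sqr (dhc i0)) (csupp_sqr (dhc i1)))).
  rewrite RintegralD//.
  - exact: (csupp_integrable _ (csupp_sqr (dhc i0))).
  - exact: (csupp_integrable _ (csupp_sqr (dhc i1))).
move=> H; apply: (le_trans H); apply: ler_wpM2r; last by rewrite ler_pM2l.
by apply: addr_ge0; apply: Rintegral_ge0 => x _; exact: sqr_ge0.
Qed.

End Ladyzhenskaya.

(** * The base flow *)

Section DeriveCombinators.
Context {R : realType}.
Implicit Types (f g : R3 R -> R) (x v : R3 R) (df dg c : R).

Lemma is_derive_cst3 x v c : is_derive x v (fun _ : R3 R => c) 0.
Proof. exact: is_derive_cst. Qed.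

Lemma is_derive_add f g x v df dg : is_derive x v f df -> is_derive x v g dg ->
  is_derive x v (fun y => f y + g y) (df + dg).
Proof. by move=> hf hg; exact: is_deriveD. Qed.

Lemma is_derive_opp f x v df : is_derive x v f df ->
  is_derive x v (fun y => - f y) (- df).
Proof. by move=> hf; exact: is_deriveN. Qed.

Lemma is_derive_mul f g x v df dg : is_derive x v f df -> is_derive x v g dg ->
  is_derive x v (fun y => f y * g y) (df * g x + f x * dg).
Proof.
move=> hf hg; apply: (is_derive_eq (@is_deriveM _ _ f g x v df dg hf hg)).
by rewrite /GRing.scale/= addrC mulrC.
Qed.

Lemma is_derive_sqr f x v df : is_derive x v f df ->
  is_derive x v (fun y => f y ^+ 2) (2 * f x * df).
Proof.
move=> hf; have := is_derive_mul hf hf.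
have -> : (fun y => f y * f y) = (fun y => f y ^+ 2) by apply/funext => y; rewrite expr2.
by move=> h; apply: (is_derive_eq h); lra.
Qed.

Lemma is_derive_inv f x v df : f x != 0 -> is_derive x v f df ->
  is_derive x v (fun y => (f y)^-1) (- df / f x ^+ 2).
Proof.
move=> fx [d1 d2]; split; first exact: derivableV.
by rewrite (deriveV fx d1) d2 /GRing.scale/= mulNr mulrC mulNr.
Qed.

Lemma is_derive_lnf f x v df : 0 < f x -> is_derive x v f df ->
  is_derive x v (fun y => ln (f y)) ((f x)^-1 * df).
Proof. by move=> fx hf; apply: is_derive_comp_real hf _; exact: is_derive1_ln. Qed.

Lemma is_derive_x x i : is_derive x (unit_vec i) (fun y : R3 R => y.1.1) (i0 == i)%:R.
Proof. exact: (is_derive_coord3 i0 i x). Qed.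

Lemma is_derive_y x i : is_derive x (unit_vec i) (fun y : R3 R => y.1.2) (i1 == i)%:R.
Proof. exact: (is_derive_coord3 i1 i x). Qed.

Lemma is_derive_z x i : is_derive x (unit_vec i) (fun y : R3 R => y.2) (i2 == i)%:R.
Proof. exact: (is_derive_coord3 i2 i x). Qed.

Lemma pderiv_is_derive f x i df : is_derive x (unit_vec i) f df -> pderiv i f x = df.
Proof. by case. Qed.

Lemma is_derive_eqr f x v df df' : is_derive x v f df -> df = df' -> is_derive x v f df'.
Proof. by move=> h <-. Qed.

End DeriveCombinators.

(** The derivative is an existential variable that is filled in by following the syntax of the
    function; [is_derive_eqr] then compares the result with the wanted formula. The conditions f x
    != 0 for inverses and 0 < f x for logarithms are left to the caller. *)
Ltac solve_derive :=
  first
  [ eassumption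
  | notypeclasses refine (is_derive_x _ _) | notypeclasses refine (is_derive_y _ _)
  | notypeclasses refine (is_derive_z _ _)
  | notypeclasses refine (is_derive_cst3 _ _ _)
  | notypeclasses refine (is_derive_add _ _); solve_derive
  | notypeclasses refine (is_derive_opp _); solve_derive
  | notypeclasses refine (is_derive_sqr _); solve_derive
  | notypeclasses refine (is_derive_mul _ _); solve_derive
  | notypeclasses refine (is_derive_inv _ _); [ | solve_derive ]
  | notypeclasses refine (is_derive_lnf _ _); [ | solve_derive ] ].

Section SmoothCombinators.
Context {R : realType}.
Variable D : set (R3 R).
Hypothesis oD : open D.
Implicit Types (f g : R3 R -> R).

Lemma smooth_addf f g : smooth_on D f -> smooth_on D g ->
  smooth_on D (fun x => f x + g x).
Proof. exact: smooth_add. Qed.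

Lemma smooth_mulf f g : smooth_on D f -> smooth_on D g ->
  smooth_on D (fun x => f x * g x).
Proof. exact: smooth_mul. Qed.

Lemma smooth_oppf f : smooth_on D f -> smooth_on D (fun x => - f x).
Proof. exact: smooth_opp. Qed.

Lemma smooth_sqrf f : smooth_on D f -> smooth_on D (fun x => f x ^+ 2).
Proof.
move=> sf; have := smooth_mulf sf sf.
by have -> : (fun y => f y * f y) = (fun y => f y ^+ 2)
  by apply/funext => y; rewrite expr2.
Qed.

Lemma smooth_cstf (c : R) : smooth_on D (fun _ => c).
Proof. exact: smooth_cst. Qed.

Lemma smooth_x : smooth_on D (fun y => y.1.1).
Proof. exact: (@smooth_coord3 R D i0). Qed.

Lemma smooth_y : smooth_on D (fun y => y.1.2).
Proof. exact: (@smooth_coord3 R D i1). Qed.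

Lemma smooth_z : smooth_on D (fun y => y.2).
Proof. exact: (@smooth_coord3 R D i2). Qed.

End SmoothCombinators.

Section BaseFlow.
Context {R : realType}.
Variables (R1 R2 alpha beta : R).
Hypotheses (R1_gt0 : 0 < R1) (R12 : R1 < R2).
Implicit Types (x : R3 R) (i k : 'I_3).

Notation D := (annulus R1 R2).

Definition rsq x : R := x.1.1 ^+ 2 + x.1.2 ^+ 2.

Let R2_gt0 : 0 < R2. Proof. exact: lt_trans R12. Qed.

Let R1sq_lt : R1 ^+ 2 < R2 ^+ 2.
Proof. by rewrite ltr_pXn2r// ?nnegrE ltW. Qed.

Lemma annulus_rsq x : D x <-> R1 ^+ 2 < rsq x /\ rsq x < R2 ^+ 2.
Proof. by split => [/andP[]|[? ?]] //; apply/andP. Qed.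

Lemma rsq_gt0 x : D x -> 0 < rsq x.
Proof. by move=> /annulus_rsq[+ _]; apply: lt_trans; rewrite exprn_gt0. Qed.

Lemma rsq_neq0 x : D x -> rsq x != 0.
Proof. by move=> /rsq_gt0/lt0r_neq0. Qed.

Lemma smooth_rsq E : open E -> smooth_on E rsq.
Proof.
by move=> oE; apply: smooth_addf => //; apply: smooth_sqrf => //; [exact: smooth_x|exact: smooth_y].
Qed.

Lemma annulus_open : open D.
Proof.
have cr : continuous rsq by move=> x; exact: (smooth_continuous _ _ x (smooth_rsq openT) I).
have -> : D = rsq @^-1` `](R1 ^+ 2), (R2 ^+ 2)[%classic.
  by apply/seteqP; split => x; rewrite /= in_itv.
by apply: open_comp => [x _|]; [exact: cr|exact: interval_open].
Qed.
Let oD := annulus_open.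

Lemma rho_gt0 x : D x -> 0 < rho x.
Proof. by move=> Dx; rewrite sqrtr_gt0; exact: rsq_gt0. Qed.

Lemma rho_sq x : rho x ^+ 2 = rsq x.
Proof. by rewrite sqr_sqrtr// addr_ge0 ?sqr_ge0. Qed.

Lemma ln_rho x : D x -> ln (rho x) = 2^-1 * ln (rsq x).
Proof.
by move=> Dx; rewrite -rho_sq lnXn ?(rho_gt0 Dx)// mulr2n mulrDr ![2^-1 * _]mulrC -splitr.
Qed.

Definition swirl_cst : R := alpha * (R1 / (R2 ^+ 2 - R1 ^+ 2)).
Definition log_cst : R := (R2 ^+ 2 - R1 ^+ 2) / ln (R2 / R1).

Local Notation K := swirl_cst.
Local Notation c := log_cst.

(* The velocity components U_theta / rho and U_z, written in terms of
   rsq x = rho x ^+ 2 so that no square root has to be differentiated. *)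
Definition angular x : R := K * (R2 ^+ 2 * (rsq x)^-1 - 1).
(** [dangular] and [daxial] are derivatives with respect to the variable rsq = rho^2; [drsq]
    supplies the inner factor of the chain rule. In terms of the overview, A = 2 rho^2 [dangular]
    and B = 2 rho [daxial]. *)
Definition dangular x : R := - (K * R2 ^+ 2 * (rsq x ^+ 2)^-1).
Definition axial x : R := beta * (4^-1 * (rsq x - R1 ^+ 2 - c * (2^-1 * ln (rsq x) - ln R1))).
Definition daxial x : R := beta * (4^-1 * (1 - c * (2^-1 * (rsq x)^-1))).
Definition drsq i x : R := 2 * x.1.1 * (i0 == i)%:R + 2 * x.1.2 * (i1 == i)%:R.

Lemma is_derive_rsq x i : is_derive x (unit_vec i) rsq (drsq i x).
Proof. by rewrite /rsq; notypeclasses refine (is_derive_eqr _ _); [solve_derive|]. Qed.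

Lemma is_derive_angular x i : D x ->
  is_derive x (unit_vec i) angular (dangular x * drsq i x).
Proof.
move=> Dx; have := is_derive_rsq x i; have := rsq_neq0 Dx => r0 dr.
rewrite /angular; notypeclasses refine (is_derive_eqr _ _); first solve_derive => //.
by rewrite /dangular /= /GRing.scale/=; field.
Qed.

Lemma is_derive_dangular x i : D x ->
  is_derive x (unit_vec i) dangular (2 * K * R2 ^+ 2 / rsq x ^+ 3 * drsq i x).
Proof.
move=> Dx; have := is_derive_rsq x i; have := rsq_neq0 Dx => r0 dr.
rewrite /dangular; notypeclasses refine (is_derive_eqr _ _).
  by solve_derive; rewrite expf_neq0.
by rewrite /= /GRing.scale/=; field.
Qed.

Lemma is_derive_axial x i : D x ->
  is_derive x (unit_vec i) axial (daxial x * drsq i x).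
Proof.
move=> Dx; have := is_derive_rsq x i; have := rsq_neq0 Dx => r0 dr.
rewrite /axial; notypeclasses refine (is_derive_eqr _ _); first solve_derive; first exact: rsq_gt0.
by rewrite /daxial /= /GRing.scale/=; field.
Qed.

Lemma is_derive_daxial x i : D x ->
  is_derive x (unit_vec i) daxial (beta / 8 * c / rsq x ^+ 2 * drsq i x).
Proof.
move=> Dx; have := is_derive_rsq x i; have := rsq_neq0 Dx => r0 dr.
rewrite /daxial; notypeclasses refine (is_derive_eqr _ _); first solve_derive => //.
by rewrite /= /GRing.scale/=; field.
Qed.

(** Since rho e_theta = (- y, x, 0), the Cartesian components of the base flow involve only x, y and
    functions of rsq. They agree with [baseU] on the annulus. *)
Definition flow k : R3 R -> R :=
  if k == i0 then fun x => - x.1.2 * angular x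
  else if k == i1 then fun x => x.1.1 * angular x else axial.

Definition dflow i k : R3 R -> R :=
  if k == i0 then fun x => - (i1 == i)%:R * angular x - x.1.2 * (dangular x * drsq i x)
  else if k == i1 then fun x => (i0 == i)%:R * angular x + x.1.1 * (dangular x * drsq i x)
  else fun x => daxial x * drsq i x.

Definition pressure x : R :=
  2^-1 * K ^+ 2 * (rsq x - R2 ^+ 4 * (rsq x)^-1 - 2 * R2 ^+ 2 * ln (rsq x)) + beta * x.2.

Lemma baseU_flow k x : D x -> component (baseU R1 R2 alpha beta) k x = flow k x.
Proof.
move=> Dx; have r0 := rho_gt0 Dx; have r0' := lt0r_neq0 r0.
have E := rho_sq x.
elim/all3: k; rewrite /component /baseU /flow /coord3 /= !(tnth_nth 0)/=
  /GRing.scale/= /GRing.scale/= ?mulr0 ?addr0 ?add0r.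
- by rewrite /angular /swirl_cst /UC -E; field; rewrite r0' subr_eq0 gt_eqF.
- by rewrite /angular /swirl_cst /UC -E; field; rewrite r0' subr_eq0 gt_eqF.
- rewrite /axial /UP [ln (rho x / R1)]ln_div ?posrE ?(rho_gt0 Dx)// (ln_rho Dx).
  by rewrite E mulr1 /log_cst; ring.
Qed.

Lemma baseP_pressure x : D x -> baseP R1 R2 alpha beta x = pressure x.
Proof.
move=> Dx; have r0 := rho_gt0 Dx; have r0' := lt0r_neq0 r0.
rewrite /baseP /pressure /PC (ln_rho Dx) -rho_sq /swirl_cst.
by field; rewrite r0' subr_eq0 gt_eqF.
Qed.

Lemma is_derive_flow i k x : D x -> is_derive x (unit_vec i) (flow k) (dflow i k x).
Proof.
move=> Dx; have da := is_derive_angular i Dx; have dx := is_derive_axial i Dx.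
elim/all3: k; rewrite /flow /dflow /=; [| |exact: dx];
  by notypeclasses refine (is_derive_eqr _ _); [solve_derive|rewrite /= /GRing.scale/=; ring].
Qed.

End BaseFlow.

Section BaseFlowProperties.
Context {R : realType}.
Variables (R1 R2 alpha beta : R).
Hypotheses (R1_gt0 : 0 < R1) (R12 : R1 < R2).
Implicit Types (x : R3 R) (i k : 'I_3).

Notation D := (annulus R1 R2).
Notation flow := (flow R1 R2 alpha beta).
Notation dflow := (dflow R1 R2 alpha beta).
Notation pressure := (pressure R1 R2 alpha beta).
Notation angular := (angular R1 R2 alpha).
Notation dangular := (dangular R1 R2 alpha).
Notation axial := (axial R1 R2 beta).
Notation daxial := (daxial R1 R2 beta).
Notation K := (swirl_cst R1 R2 alpha).
Notation c := (log_cst R1 R2).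

Let oD : open D := @annulus_open R R1 R2.

(** Only the pure second derivatives are needed, for the Laplacian; [d2] is that of rsq and [a2] the
    derivative of [dangular] in rsq. *)
Definition d2flow i k x : R :=
  let dd := drsq i x in let d2 := 2 * (i0 == i)%:R + 2 * (i1 == i)%:R in
  let a2 := 2 * K * R2 ^+ 2 / rsq x ^+ 3 in
  if k == i0 then - (2 * (i1 == i)%:R * (dangular x * dd)
                     + x.1.2 * (a2 * dd ^+ 2 + dangular x * d2))
  else if k == i1 then 2 * (i0 == i)%:R * (dangular x * dd)
                     + x.1.1 * (a2 * dd ^+ 2 + dangular x * d2)
  else beta / 8 * c / rsq x ^+ 2 * dd ^+ 2 + daxial x * d2.

Lemma is_derive_drsq i x :
  is_derive x (unit_vec i) (drsq i) (2 * (i0 == i)%:R + 2 * (i1 == i)%:R).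
Proof.
rewrite /drsq; notypeclasses refine (is_derive_eqr _ _); first solve_derive.
by elim/all3: i => /=; ring.
Qed.

Lemma is_derive_dflow i k x : D x ->
  is_derive x (unit_vec i) (dflow i k) (d2flow i k x).
Proof.
move=> Dx; have dr := is_derive_drsq i x.
have da := is_derive_angular alpha R1_gt0 i Dx; have db := is_derive_daxial beta R1_gt0 i Dx.
have dda := is_derive_dangular alpha R1_gt0 i Dx.
elim/all3: k; rewrite /dflow /d2flow /=;
  by notypeclasses refine (is_derive_eqr _ _); [solve_derive|rewrite /=; ring].
Qed.

(** The first term is the centrifugal balance: the radial pressure gradient is U_theta^2 / rho, that
    is rho [angular]^2. *)
Definition dpressure k x : R := 2^-1 * angular x ^+ 2 * drsq k x + beta * (i2 == k)%:R.

Lemma is_derive_pressure k x : D x ->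
  is_derive x (unit_vec k) pressure (dpressure k x).
Proof.
move=> Dx; have dr := is_derive_rsq x k; have r0 := rsq_neq0 R1_gt0 Dx.
rewrite /pressure; notypeclasses refine (is_derive_eqr _ _); first solve_derive => //.
  exact: (rsq_gt0 R1_gt0 Dx).
by rewrite /dpressure /angular /=; field.
Qed.

Lemma laplacian_flow k x : D x -> laplacian (flow k) x = \sum_(i < 3) d2flow i k x.
Proof.
move=> Dx; apply: eq_bigr => i _.
rewrite (pderiv_open _ _ (dflow i k) _ _ oD _ Dx); last first.
  by move=> y Dy; apply: pderiv_is_derive; exact: is_derive_flow.
by apply: pderiv_is_derive; exact: is_derive_dflow.
Qed.

Lemma flow_steady_NS k x : D x ->
  - laplacian (flow k) x + (\sum_(i < 3) flow i x * dflow i k x) + dpressure k x = 0.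
Proof.
move=> Dx; rewrite laplacian_flow// !sum3; have r0 := rsq_neq0 R1_gt0 Dx.
elim/all3: k; rewrite /d2flow /dpressure /flow /dflow /drsq /= /dangular /daxial.
- by rewrite /rsq in r0 *; field.
- by rewrite /rsq in r0 *; field.
- by rewrite /rsq in r0 *; field.
Qed.

Let sr : smooth_on D rsq := smooth_rsq oD.

Let si : smooth_on D (fun x => (rsq x)^-1) :=
  smooth_inv _ _ oD (fun x Dx => rsq_neq0 R1_gt0 Dx) sr.

Let sl : smooth_on D (fun x => ln (rsq x)) :=
  smooth_ln _ _ oD (fun x Dx => rsq_gt0 R1_gt0 Dx) sr.

Lemma smooth_angular : smooth_on D angular.
Proof.
exact (smooth_mulf oD (@smooth_cstf R D K)
  (smooth_addf oD (smooth_mulf oD (@smooth_cstf R D (R2 ^+ 2)) si) (@smooth_cstf R D (- 1)))).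
Qed.

Lemma smooth_axial : smooth_on D axial.
Proof.
exact (smooth_mulf oD (@smooth_cstf R D beta) (smooth_mulf oD (@smooth_cstf R D 4^-1)
  (smooth_addf oD (smooth_addf oD sr (@smooth_cstf R D (- R1 ^+ 2)))
  (smooth_oppf oD (smooth_mulf oD (@smooth_cstf R D c) (smooth_addf oD
    (smooth_mulf oD (@smooth_cstf R D 2^-1) sl) (@smooth_cstf R D (- ln R1)))))))).
Qed.

Lemma smooth_flow k : smooth_on D (flow k).
Proof.
elim/all3: k.
- exact (smooth_mulf oD (smooth_oppf oD (@smooth_y R D)) smooth_angular).
- exact (smooth_mulf oD (@smooth_x R D) smooth_angular).
- exact smooth_axial.
Qed.

Lemma smooth_pressure : smooth_on D pressure.
Proof.
exact (smooth_addf oD (smooth_mulf oD (@smooth_cstf R D (2^-1 * K ^+ 2))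
  (smooth_addf oD (smooth_addf oD sr (smooth_oppf oD
     (smooth_mulf oD (@smooth_cstf R D (R2 ^+ 4)) si)))
   (smooth_oppf oD (smooth_mulf oD (@smooth_cstf R D (2 * R2 ^+ 2)) sl))))
  (smooth_mulf oD (@smooth_cstf R D beta) (@smooth_z R D))).
Qed.

(** With t = exp y this is y <= sinh y for y >= 0; the derivative of the difference is a square
    divided by exp y. *)
Lemma ln_le_half_subV (t : R) : 1 <= t -> 2 * ln t <= t - t^-1.
Proof.
move=> t1; have t0 : 0 < t by exact: lt_le_trans t1.
pose f (y : R) := expR y - expR (- y) - 2 * y.
have df (y : R) : is_derive y (1:R) f (expR y + expR (- y) - 2).
  have d1 := is_derive_expR y; have d2 : is_derive y (1:R) (fun z => expR (- z)) (- expR (- y)).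
    apply: (is_derive_eq (@is_derive1_comp _ expR -%R y (expR (- y)) (- 1) _ _)).
    by rewrite mulrN1.
  by rewrite /f; apply: is_derive_eq; rewrite /GRing.scale/=; ring.
have f0 : f 0 <= f (ln t).
  apply: (@ger0_derive1_ndecry _ f 0) => //.
  - move=> y _; rewrite derive1E; have [_ ->] := df y.
    have e0 : 0 < expR y by exact: expR_gt0.
    rewrite expRN -(@ler_pM2r _ (expR y))// mul0r mulrBl mulrDl mulVf ?gt_eqF//.
    have := sqr_ge0 (expR y - 1); rewrite sqrrB; lra.
  - apply: continuous_subspaceT => y.
    by apply: differentiable_continuous; apply/derivable1_diffP; have [] := df y.
  - exact: ln_ge0.
move: f0; rewrite /f oppr0 expR0 expRN lnK ?posrE//; lra.
Qed.

(** The right side is the logarithmic mean of R1^2 and R2^2, the left side their geometric mean; the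
    previous inequality is taken at t = R2 / R1. *)
Lemma log_mean_ge : R1 * R2 <= c / 2.
Proof.
have R20 : 0 < R2 by exact: lt_trans R12.
have t1 : 1 < R2 / R1 by rewrite ltr_pdivlMr// mul1r.
have l0 : 0 < ln (R2 / R1) by exact: ln_gt0.
have := ln_le_half_subV (ltW t1); rewrite invf_div => H.
rewrite /log_cst mulrAC ler_pdivlMr// ler_pdivlMr//.
have -> : R2 ^+ 2 - R1 ^+ 2 = R1 * R2 * (R2 / R1 - R1 / R2).
  by field; rewrite !gt_eqF.
have R12p : 0 < R1 * R2 by rewrite mulr_gt0.
rewrite -mulrA ler_pM2l//; lra.
Qed.

(** The left side is (A^2 + B^2) / 4, and each of its two terms is compared with its value at rho =
    R1. *)
Lemma Mout_bound x : D x ->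
  rsq x ^+ 2 * dangular x ^+ 2 + rsq x * daxial x ^+ 2 <= Mout R1 R2 alpha beta ^+ 2.
Proof.
move=> Dx; have r0 := rsq_gt0 R1_gt0 Dx.
have [r1 r2] := (annulus_rsq _ _ _).1 Dx.
have R20 : 0 < R2 by exact: lt_trans R12.
have R1n : R1 != 0 by rewrite gt_eqF. 
have R1sq : 0 < R1 ^+ 2 by rewrite exprn_gt0.
have d0 : R2 ^+ 2 - R1 ^+ 2 != 0 by rewrite gt_eqF// subr_gt0; lra.
have rn : rsq x != 0 by rewrite gt_eqF.
have cE : (R2 ^+ 2 - R1 ^+ 2) / ln (R2 ^+ 2 / R1 ^+ 2) = c / 2.
  rewrite /log_cst -expr_div_n lnXn ?divr_gt0// -mulr_natr; field.
  by rewrite gt_eqF// ln_gt0// ltr_pdivlMr// mul1r.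
rewrite /Mout sqr_sqrtr; last first.
  apply: addr_ge0; apply: mulr_ge0; rewrite ?sqr_ge0//.
    by apply: divr_ge0; [exact: exprn_ge0 (ltW R20)|rewrite mulr_ge0 ?sqr_ge0].
  by rewrite divr_ge0 ?sqr_ge0.
apply: lerD.
- have -> : rsq x ^+ 2 * dangular x ^+ 2 = (K * R2 ^+ 2) ^+ 2 * (rsq x ^+ 2)^-1.
    by rewrite /dangular; field.
  have -> : alpha ^+ 2 * (R2 ^+ 4 / ((R2 ^+ 2 - R1 ^+ 2) ^+ 2 * R1 ^+ 2)) =
      (K * R2 ^+ 2) ^+ 2 * ((R1 ^+ 2) ^+ 2)^-1.
    by rewrite /swirl_cst; field; rewrite R1n d0.
  by rewrite ler_wpM2l ?sqr_ge0// lef_pV2 ?posrE ?exprn_gt0// lerXn2r ?nnegrE ?ltW.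
- have -> : (R2 ^+ 2 - R1 ^+ 2) / (R1 * ln (R2 ^+ 2 / R1 ^+ 2)) = c / 2 / R1.
    by rewrite -cE invfM [RHS]mulrAC mulrA.
  have -> : rsq x * daxial x ^+ 2 = beta ^+ 2 / 16 * ((rsq x - c / 2) ^+ 2 / rsq x).
    by rewrite /daxial; field.
  rewrite ler_wpM2l// ?divr_ge0 ?sqr_ge0//.
  (* The difference of the two values is written as a product: its first factor is nonnegative
     because rsq > R1^2, its second because rsq < R2^2 and R1 R2 <= c / 2. *)
  have -> : (c / 2 / R1 - R1) ^+ 2 = (rsq x - c / 2) ^+ 2 / rsq x +
      (rsq x - R1 ^+ 2) * ((c / 2) ^+ 2 - R1 ^+ 2 * rsq x) / (R1 ^+ 2 * rsq x).
    by field; rewrite R1n rn.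
  rewrite lerDl; apply: divr_ge0; last by rewrite mulr_ge0 ?ltW.
  apply: mulr_ge0; first by rewrite subr_ge0 ltW.
  rewrite subr_ge0.
  apply: (@le_trans _ _ (R1 ^+ 2 * R2 ^+ 2)); first by rewrite ler_wpM2l ?ltW.
  have m0 : 0 < R1 * R2 by rewrite mulr_gt0.
  rewrite -exprMn; apply: lerXn2r; rewrite ?nnegrE; [exact: ltW| |exact: log_mean_ge].
  exact: ltW (lt_le_trans m0 log_mean_ge).
Qed.

(** Only w_rho (A w_theta + B w_z) remains of the quadratic form of grad U: the part of the gradient
    that comes from rigid rotation is antisymmetric and cancels. *)
Lemma shear_bound x (w : R3 R) : D x ->
  - (Mout R1 R2 alpha beta * \sum_(k < 3) coord3 k w ^+ 2) <=
  \sum_(k < 3) (\sum_(i < 3) coord3 i w * dflow i k x) * coord3 k w.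
Proof.
move=> Dx; have r0 := rsq_gt0 R1_gt0 Dx; have rn : rsq x != 0 by rewrite gt_eqF.
have HM := Mout_bound Dx; have M0 : 0 <= Mout R1 R2 alpha beta by exact: sqrtr_ge0.
rewrite !sum3 /dflow /drsq /= -/(coord3 i0 w).
set w0 := coord3 i0 w; set w1 := coord3 i1 w; set w2 := coord3 i2 w.
set X := x.1.1; set Y := x.1.2.
(* These are rho w_rho and rho w_theta, free of square roots. *)
pose P := X * w0 + Y * w1; pose Q := X * w1 - Y * w0.
set a := dangular x; set b := daxial x.
set F := (X in _ <= X).
have FE : F = 2 * (P * (a * Q + b * w2)) by rewrite /F /P /Q; ring.
have PQ : P ^+ 2 + Q ^+ 2 = rsq x * (w0 ^+ 2 + w1 ^+ 2).
  by rewrite /P /Q /rsq -/X -/Y; ring.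
pose T := w0 ^+ 2 + w1 ^+ 2 + w2 ^+ 2.
have T0 : 0 <= T by rewrite !addr_ge0 ?sqr_ge0.
(* [p] is w_rho^2 and [q] is w_theta^2 + w_z^2; the factor 1/2 of the overview is the inequality 4 p
   q <= (p + q)^2. *)
pose p := P ^+ 2 / rsq x; pose q := Q ^+ 2 / rsq x + w2 ^+ 2.
have pq : p + q = T.
  by rewrite /p /q /T addrA -mulrDl PQ mulrC mulKf.
(* Cauchy-Schwarz for (rho a, b) and (w_theta, w_z), with the remainder of Lagrange's identity. *)
have CS : (a * Q + b * w2) ^+ 2 <= (rsq x * a ^+ 2 + b ^+ 2) * q.
  have -> : (rsq x * a ^+ 2 + b ^+ 2) * q = (a * Q + b * w2) ^+ 2 +
      (rsq x * a * w2 - b * Q) ^+ 2 / rsq x by rewrite /q; field.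
  by rewrite lerDl divr_ge0 ?sqr_ge0 ?ltW.
have F2 : F ^+ 2 <= (Mout R1 R2 alpha beta * T) ^+ 2.
  have -> : F ^+ 2 = 4 * P ^+ 2 * (a * Q + b * w2) ^+ 2 by rewrite FE; ring.
  apply: (@le_trans _ _ (4 * P ^+ 2 * ((rsq x * a ^+ 2 + b ^+ 2) * q))).
    by rewrite ler_wpM2l// mulr_ge0 ?sqr_ge0.
  have -> : 4 * P ^+ 2 * ((rsq x * a ^+ 2 + b ^+ 2) * q) =
     (rsq x ^+ 2 * a ^+ 2 + rsq x * b ^+ 2) * (4 * p * q) by rewrite /p; field.
  rewrite [leRHS]exprMn; apply: ler_pM => //.
  - apply: addr_ge0; apply: mulr_ge0; do ?exact: sqr_ge0.
    exact: ltW.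
  - have p0 : 0 <= p by apply: divr_ge0; [exact: sqr_ge0|exact: ltW].
    have q0 : 0 <= q.
      apply: addr_ge0; last exact: sqr_ge0.
      by apply: divr_ge0; [exact: sqr_ge0|exact: ltW].
    by apply: mulr_ge0 => //; apply: mulr_ge0.
  - by rewrite -pq; have := sqr_ge0 (p - q); lra.
rewrite lerNl -/T; apply: (le_trans (ler_norm _)); rewrite normrN.
by rewrite -(@ler_pXn2r _ 2) ?nnegrE ?mulr_ge0// -normrX ger0_norm ?sqr_ge0.
Qed.

End BaseFlowProperties.

(** * Barta's inequality *)

Section BoundedOn.
Context {R : realType}.
Variable D : set (R3 R).
Implicit Types (f g : R3 R -> R).

Definition bounded_on f := exists C : R, forall x, D x -> `|f x| <= C.

Lemma bounded_cst (c : R) : bounded_on (fun _ => c).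
Proof. by exists `|c|. Qed.

Lemma bounded_add f g : bounded_on f -> bounded_on g -> bounded_on (fun x => f x + g x).
Proof.
move=> [A fA] [B gB]; exists (A + B) => x Dx.
by rewrite (le_trans (ler_normD _ _))// lerD ?fA ?gB.
Qed.

Lemma bounded_opp f : bounded_on f -> bounded_on (fun x => - f x).
Proof. by move=> [A fA]; exists A => x Dx; rewrite normrN fA. Qed.

Lemma bounded_mul f g : bounded_on f -> bounded_on g -> bounded_on (fun x => f x * g x).
Proof.
move=> [A fA] [B gB]; exists (A * B) => x Dx.
by rewrite normrM ler_pM ?fA ?gB.
Qed.

Lemma bounded_sqr f : bounded_on f -> bounded_on (fun x => f x ^+ 2).
Proof. by move=> bf; exact: (bounded_mul bf bf). Qed.

End BoundedOn.

(** * Boundedness of the base flow and of its gradient *)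

Section BaseFlowBounds.
Context {R : realType}.
Variables (R1 R2 alpha beta : R).
Hypotheses (R1_gt0 : 0 < R1) (R12 : R1 < R2).
Notation D := (annulus R1 R2).

Let R2_gt0 : 0 < R2. Proof. exact: lt_trans R12. Qed.

Lemma annulus_coord_lt (x : R3 R) : D x -> `|x.1.1| < R2 /\ `|x.1.2| < R2.
Proof.
move=> /annulus_rsq[_]; rewrite /rsq => h.
by split; rewrite -(@ltr_pXn2r _ 2) ?nnegrE ?normr_ge0 ?(ltW R2_gt0)// -normrX ger0_norm ?sqr_ge0//;
  have := sqr_ge0 x.1.1; have := sqr_ge0 x.1.2; lra.
Qed.

Let bx : bounded_on D (fun x => x.1.1).
Proof. by exists R2 => x /annulus_coord_lt[/ltW]. Qed.

Let by' : bounded_on D (fun x => x.1.2).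
Proof. by exists R2 => x /annulus_coord_lt[_ /ltW]. Qed.

Let bV : bounded_on D (fun x => (rsq x)^-1).
Proof.
exists (R1 ^+ 2)^-1 => x Dx; have r0 := rsq_gt0 R1_gt0 Dx.
have [r1 _] := (annulus_rsq _ _ _).1 Dx.
by rewrite ger0_norm ?invr_ge0 ?(ltW r0)// lef_pV2 ?posrE ?exprn_gt0// ltW.
Qed.

Let bl : bounded_on D (fun x => ln (rsq x)).
Proof.
exists (`|ln (R1 ^+ 2)| + `|ln (R2 ^+ 2)|) => x Dx; have r0 := rsq_gt0 R1_gt0 Dx.
have [r1 r2] := (annulus_rsq _ _ _).1 Dx.
have l1 : ln (R1 ^+ 2) <= ln (rsq x) by rewrite ler_ln ?posrE ?exprn_gt0// ltW.
have l2 : ln (rsq x) <= ln (R2 ^+ 2) by rewrite ler_ln ?posrE ?exprn_gt0// ltW.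
rewrite ler_norml; have := ler_norm (ln (R2 ^+ 2)); have := ler_norm (- ln (R1 ^+ 2)).
have := normr_ge0 (ln (R2 ^+ 2)); have := normr_ge0 (ln (R1 ^+ 2)).
rewrite normrN; lra.
Qed.

Ltac solve_bounded :=
  first [ exact bx | exact by' | exact bV | exact bl | exact (@bounded_cst R D _)
  | apply bounded_add; solve_bounded
  | apply bounded_opp; solve_bounded
  | apply bounded_sqr; solve_bounded
  | apply bounded_mul; solve_bounded ].

Lemma bounded_flow k : bounded_on D (flow R1 R2 alpha beta k).
Proof.
have br : bounded_on D rsq by rewrite /rsq; solve_bounded.
elim/all3: k; rewrite /flow /angular /axial /=.
- by apply: bounded_mul; solve_bounded.
- by apply: bounded_mul; solve_bounded.
- apply: bounded_mul; first solve_bounded.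
  apply: bounded_mul; first solve_bounded.
  apply: bounded_add; last solve_bounded.
  by apply: bounded_add => //; solve_bounded.
Qed.

Lemma bounded_dflow i k : bounded_on D (dflow R1 R2 alpha beta i k).
Proof.
have bV2 : bounded_on D (fun x => (rsq x ^+ 2)^-1).
  have [C hC] := bounded_sqr bV; exists C => x /hC.
  by rewrite exprVn.
have bd : bounded_on D (drsq i) by rewrite /drsq; solve_bounded.
have bda : bounded_on D (dangular R1 R2 alpha).
  by rewrite /dangular; apply: bounded_opp; apply: bounded_mul => //; solve_bounded.
have bm := bounded_mul bda bd.
elim/all3: k; rewrite /dflow /=.
- apply: bounded_add.
    by rewrite /angular; solve_bounded.
  by apply: bounded_opp; apply: bounded_mul => //; solve_bounded.
- apply: bounded_add.
    by rewrite /angular; solve_bounded.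
  by apply: bounded_mul => //; solve_bounded.
- by apply: bounded_mul => //; rewrite /daxial; solve_bounded.
Qed.

End BaseFlowBounds.

Section Barta.
Context {R : realType}.
Variable D : set (R3 R).
Hypothesis oD : open D.

(* For F = grad w / w the hypothesis on F says that - laplacian w >= lambda w. *)
Lemma barta (F : 'I_3 -> R3 R -> R) (lambda : R) (phi : R3 R -> R) :
  (forall i, smooth_on D (F i)) ->
  (forall x, D x -> \sum_(i < 3) (F i x ^+ 2 + pderiv i (F i) x) <= - lambda) ->
  test_function D phi ->
  lambda * ip D phi phi <= \sum_(i < 3) ip D (pderiv i phi) (pderiv i phi).
Proof.
have key (a0 a1 a2 s0 s1 s2 l p : R) : 0 <= a0 -> 0 <= a1 -> 0 <= a2 ->
    (s0 + s1 + s2) * p <= - l * p ->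
    l * p <= a0 - s0 * p + (a1 - s1 * p) + (a2 - s2 * p).
  by rewrite !mulrDl mulNr; lra.
move=> sF hF tphi; have mD := open_measurable3 _ oD.
have sphi : smooth_on D phi := test_smooth _ _ D tphi.
have tphi2 : test_function D (phi \* phi) := test_mul _ _ _ oD sphi tphi.
pose psi i := F i \* (phi \* phi).
have tpsi i : test_function D (psi i) := test_mul _ _ _ oD (sF i) tphi2.
have Lphi := L2_test oD tphi.
have Ldphi i := L2_test oD (test_pderiv _ _ i tphi).
have Idphi i := L2_mul_integrable oD (Ldphi i) (Ldphi i).
have Ipsi i : lebesgue3.-integrable D (EFin \o pderiv i (psi i)).
  apply: (integrableS measurableT mD (@subsetT _ D)).
  by apply: csupp_integrable; exact: test_csupp (test_pderiv _ _ i (tpsi i)).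
(* The subtracted derivative of F_i phi^2 integrates to zero and completes a square: E_i = (d_i phi
   - F_i phi)^2 - (F_i^2 + d_i F_i) phi^2. *)
pose E i x := pderiv i phi x * pderiv i phi x - pderiv i (psi i) x.
have IE i : lebesgue3.-integrable D (EFin \o E i).
  by have := integrableB mD (Idphi i) (Ipsi i); apply: eq_integrable.
have EE i : \int[lebesgue3]_(x in D) E i x = ip D (pderiv i phi) (pderiv i phi).
  by rewrite /E RintegralB// (Rintegral_pderiv_test i (tpsi i)) subr0.
have I2 : lebesgue3.-integrable D (EFin \o (fun x => E i0 x + E i1 x)).
  by have := integrableD mD (IE i0) (IE i1); apply: eq_integrable.
have I3 : lebesgue3.-integrable D (EFin \o (fun x => E i0 x + E i1 x + E i2 x)).
  by have := integrableD mD I2 (IE i2); apply: eq_integrable.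
have -> : \sum_(i < 3) ip D (pderiv i phi) (pderiv i phi) =
    \int[lebesgue3]_(x in D) (E i0 x + E i1 x + E i2 x).
  by rewrite sum3 (RintegralD mD I2 (IE i2)) (RintegralD mD (IE i0) (IE i1)) !EE.
rewrite /ip -(RintegralZl lambda mD (L2_mul_integrable oD Lphi Lphi)).
have Il : lebesgue3.-integrable D (EFin \o (fun x => lambda * (phi x * phi x))).
  exact: (integrableZl mD lambda (L2_mul_integrable oD Lphi Lphi)).
apply: le_Rintegral => // x Dx.
have Ei i : E i x = (pderiv i phi x - F i x * phi x) ^+ 2 -
    (F i x ^+ 2 + pderiv i (F i) x) * phi x ^+ 2.
  rewrite /E /psi (pderivM _ _ _ _ _ (sF i) (test_smooth _ _ D tphi2) Dx).
  rewrite (pderivM _ _ _ _ _ sphi sphi Dx) /=; ring.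
rewrite !Ei; have := hF x Dx; rewrite sum3 => {}hF.
rewrite -expr2; apply: key; [exact: sqr_ge0..|by apply: ler_wpM2r hF; exact: sqr_ge0].
Qed.

End Barta.

Section Trigonometric.
Context {R : realType}.
Variable D : set (R3 R).
Hypothesis oD : open D.
Implicit Types (f : R3 R -> R).

Lemma is_derive_sinf f (x v : R3 R) (df : R) : is_derive x v f df ->
  is_derive x v (fun y => sin (f y)) (cos (f x) * df).
Proof. by move=> hf; apply: is_derive_comp_real hf _; exact: is_derive_sin. Qed.

Lemma is_derive_cosf f (x v : R3 R) (df : R) : is_derive x v f df ->
  is_derive x v (fun y => cos (f y)) (- sin (f x) * df).
Proof. by move=> hf; apply: is_derive_comp_real hf _; exact: is_derive_cos. Qed.

(** Each of the two functions appears in the derivative of the other, so the induction treats them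
    together. *)
Lemma Ck_sin_cos n f : Ck n D f ->
  Ck n D (fun x => sin (f x)) /\ Ck n D (fun x => cos (f x)).
Proof.
have cs x : {for x, continuous f} -> {for x, continuous (fun x => sin (f x))}.
  by move=> cf; apply: continuous_comp_real => //; exact: continuous_sin.
have cc x : {for x, continuous f} -> {for x, continuous (fun x => cos (f x))}.
  by move=> cf; apply: continuous_comp_real => //; exact: continuous_cos.
elim: n => [[cf _]|n IH Cf'].
  by split; split => // x Dx; [apply: cs|apply: cc]; exact: cf.
have /CkS[cf df Cf] := Cf'; have [Cs Cc] := IH (CkW _ _ _ Cf').
have dsn x i (Dx : D x) := is_derive_sinf (is_derive_pderiv _ _ _ (df x i Dx)).
have dcs x i (Dx : D x) := is_derive_cosf (is_derive_pderiv _ _ _ (df x i Dx)).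
split; apply/CkS; split => [x Dx|x i Dx|i].
- exact/cs/cf.
- by have [] := dsn x i Dx.
- apply: (Ck_eq _ _ _ _ oD _ (Ck_mul _ _ _ _ oD Cc (Cf i))) => x Dx /=.
  by rewrite (pderiv_is_derive (dsn x i Dx)).
- exact/cc/cf.
- by have [] := dcs x i Dx.
- apply: (Ck_eq _ _ _ _ oD _ (Ck_mul _ _ _ _ oD (Ck_opp _ _ _ oD Cs) (Cf i))) => x Dx /=.
  by rewrite (pderiv_is_derive (dcs x i Dx)).
Qed.

Lemma smooth_sin f : smooth_on D f -> smooth_on D (fun x => sin (f x)).
Proof. by move=> /smoothP Cf; apply/smoothP => n; exact: (Ck_sin_cos (Cf n)).1. Qed.

Lemma smooth_cos f : smooth_on D f -> smooth_on D (fun x => cos (f x)).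
Proof. by move=> /smoothP Cf; apply/smoothP => n; exact: (Ck_sin_cos (Cf n)).2. Qed.

End Trigonometric.

(** * The two explicit Poincare constants *)

Section Poincare.
Context {R : realType}.
Variables (R1 R2 : R).
Hypotheses (R1_gt0 : 0 < R1) (R12 : R1 < R2).
Notation D := (annulus R1 R2).
Let oD : open D := @annulus_open R R1 R2.
Let R2_gt0 : 0 < R2. Proof. exact: lt_trans R12. Qed.

(* Barta's bound with w = cos (pi x / (2 R2)) cos (pi y / (2 R2)). *)
Lemma poincare_pi phi : test_function D phi ->
  pi ^+ 2 / (2 * R2 ^+ 2) * ip D phi phi <=
  \sum_(i < 3) ip D (pderiv i phi) (pderiv i phi).
Proof.
move=> tphi; pose k : R := pi / (2 * R2).
have k0 : 0 < k by rewrite divr_gt0 ?pi_gt0// mulr_gt0.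
have R2n : R2 != 0 by rewrite gt_eqF.
have cos_gt0 (t : R) : `|t| < R2 -> 0 < cos (k * t).
  move=> tR; apply: cos_gt0_pihalf.
  have : `|k * t| < pi / 2.
    rewrite normrM gtr0_norm// (_ : pi / 2 = k * R2); last by rewrite /k; field.
    by rewrite ltr_pM2l.
  by rewrite ltr_norml.
(* The logarithmic derivative of cos (k f). In each of the two horizontal directions T^2 + T' = -
   k^2, and 2 k^2 is the announced constant. *)
pose T (f : R3 R -> R) x := - k * (sin (k * f x) * (cos (k * f x))^-1).
pose F (i : 'I_3) : R3 R -> R := if i == i0 then T (fun x => x.1.1)
  else if i == i1 then T (fun x => x.1.2) else fun=> 0.
have sT f : smooth_on D f -> (forall x, D x -> `|f x| < R2) -> smooth_on D (T f).
  move=> sf fR; have skf := smooth_mulf oD (@smooth_cstf R D k) sf.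
  have cn x : D x -> cos (k * f x) != 0 by move=> Dx; rewrite gt_eqF// cos_gt0// fR.
  exact (smooth_mulf oD (@smooth_cstf R D (- k)) (smooth_mulf oD (smooth_sin oD skf)
    (smooth_inv _ _ oD cn (smooth_cos oD skf)))).
have dT (f : R3 R -> R) x i : D x -> `|f x| < R2 -> is_derive x (unit_vec i) f (1 : R) ->
    T f x ^+ 2 + pderiv i (T f) x = - k ^+ 2.
  move=> Dx fR df; have cn : cos (k * f x) != 0 by rewrite gt_eqF// cos_gt0.
  have dk : is_derive x (unit_vec i) (fun y => k * f y) (k * 1).
    by notypeclasses refine (is_derive_eqr _ _); [solve_derive|rewrite /=; ring].
  have ds := is_derive_sinf dk; have dc := is_derive_cosf dk.
  have dTf : is_derive x (unit_vec i) (T f) (- k ^+ 2 - T f x ^+ 2).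
    by rewrite /T; notypeclasses refine (is_derive_eqr _ _); [solve_derive => //|
      rewrite /=; field].
  by rewrite (pderiv_is_derive dTf); ring.
apply: (@barta _ _ oD F) => // [|x Dx].
  elim/all3; rewrite /F /=.
  - by apply: sT; [exact: smooth_x|move=> x /annulus_coord_lt[]].
  - by apply: sT; [exact: smooth_y|move=> x /annulus_coord_lt[]].
  - exact: smooth_cstf.
have [hx hy] := annulus_coord_lt R1_gt0 R12 Dx.
rewrite sum3 /F /= (dT _ x i0 Dx hx (is_derive_x x i0)).
rewrite (dT _ x i1 Dx hy (is_derive_y x i1)).
rewrite (pderiv_is_derive (is_derive_cst3 x (unit_vec i2) 0)) expr0n/= !addr0.
by rewrite /k le_eqVlt; apply/orP; left; apply/eqP; field.
Qed.

(** With a = R1^2, b = R2^2, r = rsq x, A = ln (r / a) and B = ln (b / r), the function is (A (b -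
    r) - B (r - a)) / (4 (A + B)). Both bounds follow from exp t > 1 + t at t = A, -A, B, -B, which
    gives a A < r - a < r A and r B < b - r < b B. *)
Lemma torsion_bounds x : D x -> 0 < axial R1 R2 (- 1) x /\
  axial R1 R2 (- 1) x <= (R2 ^+ 2 - R1 ^+ 2) * ln (R2 / R1) / 8.
Proof.
move=> Dx; have r0 := rsq_gt0 R1_gt0 Dx; have [] := (annulus_rsq _ _ _).1 Dx.
set r := rsq x; set a := R1 ^+ 2; set b := R2 ^+ 2 => ar rb.
have a0 : 0 < a by rewrite exprn_gt0.
have b0 : 0 < b by rewrite exprn_gt0.
have an : a != 0 by rewrite gt_eqF.
have bn : b != 0 by rewrite gt_eqF.
have rn : r != 0 by rewrite gt_eqF.
pose A := ln (r / a); pose B := ln (b / r).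
have A0 : 0 < A by rewrite ln_gt0// ltr_pdivlMr// mul1r.
have B0 : 0 < B by rewrite ln_gt0// ltr_pdivlMr// mul1r.
have eA : expR A = r / a by rewrite lnK// posrE divr_gt0.
have eB : expR B = b / r by rewrite lnK// posrE divr_gt0.
have h1 : a * A < r - a.
  have := @expR_gt1Dx _ A (lt0r_neq0 A0).
  by rewrite eA ltr_pdivlMr// mulrDl mul1r [a * A]mulrC; lra.
have h2 : r - a < r * A.
  have := @expR_gt1Dx _ (- A); rewrite oppr_eq0 lt0r_neq0// => /(_ isT).
  by rewrite expRN eA invf_div ltr_pdivlMr// mulrDl mul1r mulNr [r * A]mulrC; lra.
have h3 : r * B < b - r.
  have := @expR_gt1Dx _ B (lt0r_neq0 B0).
  by rewrite eB ltr_pdivlMr// mulrDl mul1r [r * B]mulrC; lra.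
have h4 : b - r < b * B.
  have := @expR_gt1Dx _ (- B); rewrite oppr_eq0 lt0r_neq0// => /(_ isT).
  by rewrite expRN eB invf_div ltr_pdivlMr// mulrDl mul1r mulNr [b * B]mulrC; lra.
have EA : A = ln r - ln R1 *+ 2.
  by rewrite -lnXn// -ln_div// ?posrE// (lt_trans a0 ar).
have EB : B = ln R2 *+ 2 - ln r.
  by rewrite -lnXn// -ln_div// ?posrE// (lt_trans a0 ar).
have EL : ln (R2 / R1) = ln R2 - ln R1 by rewrite ln_div ?posrE.
have AB0 : 0 < A + B by rewrite addr_gt0.
have lA : 2^-1 * ln r - ln R1 = A / 2 by rewrite EA; field.
have lAB : ln (R2 / R1) = (A + B) / 2 by rewrite EL EA EB; field.
have -> : axial R1 R2 (- 1) x = (A * (b - r) - B * (r - a)) / (A + B) / 4.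
  rewrite /axial -/r lA /log_cst lAB -/a -/b; field.
  by rewrite gt_eqF.
rewrite lAB; split.
  rewrite !divr_gt0// subr_gt0.
  have g1 : A * (r * B) < A * (b - r) by rewrite ltr_pM2l.
  have g2 : B * (r - a) < B * (r * A) by rewrite ltr_pM2l.
  by apply: (lt_trans g2); rewrite (_ : B * (r * A) = A * (r * B))//; ring.
rewrite ler_pdivrMr// ler_pdivrMr//.
have u1 : A * (b - r) <= A * (b * B) by rewrite ler_pM2l// ltW.
have u2 : B * (a * A) <= B * (r - a) by rewrite ler_pM2l// ltW.
apply: (@le_trans _ _ (A * B * (b - a))); first by lra.
(* As A + B = 2 ln (R2 / R1), this is the source of the 8: A B (b - a) / (4 (A + B)) is at most (A +
   B) (b - a) / 16. *)
have u3 : A * B <= (A + B) ^+ 2 / 4 by have := sqr_ge0 (A - B); lra.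
have ba : 0 <= b - a by rewrite subr_ge0 ltW// (lt_trans ar rb).
have := ler_wpM2r ba u3; lra.
Qed.

(* Barta's bound with the torsion function w of the annulus, - laplacian w = 1. *)
Lemma poincare_log phi : test_function D phi ->
  8 / ((R2 ^+ 2 - R1 ^+ 2) * ln (R2 / R1)) * ip D phi phi <=
  \sum_(i < 3) ip D (pderiv i phi) (pderiv i phi).
Proof.
move=> tphi; pose W := axial R1 R2 (- 1); pose G i := dflow R1 R2 0 (- 1) i i2.
have W0 x : D x -> 0 < W x by move=> /torsion_bounds[].
have Wn x : D x -> W x != 0 by move=> Dx; rewrite gt_eqF// W0.
pose F i x := G i x * (W x)^-1.
have sW : smooth_on D W by exact: smooth_axial.
have dW i x : D x -> is_derive x (unit_vec i) W (G i x).
  exact: (is_derive_flow 0 (- 1) R1_gt0 i i2).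
have sG i : smooth_on D (G i).
  apply: smooth_eq (smooth_pderiv _ _ i sW) => // x Dx.
  exact: pderiv_is_derive (dW i x Dx).
have sF i : smooth_on D (F i) by exact (smooth_mulf oD (sG i) (smooth_inv _ _ oD Wn sW)).
apply: (barta oD sF) tphi => x Dx.
(* For F = grad W / W the sum over [i] is (laplacian W) / W = - 1 / W, so Barta's condition asks for
   an upper bound on W. *)
have FE i : F i x ^+ 2 + pderiv i (F i) x = d2flow R1 R2 0 (- 1) i i2 x / W x.
  have dG := is_derive_dflow 0 (- 1) R1_gt0 i i2 Dx.
  have dWx := dW i x Dx; have Wx := Wn x Dx.
  have dF : is_derive x (unit_vec i) (F i)
      (d2flow R1 R2 0 (- 1) i i2 x / W x - F i x ^+ 2).
    rewrite /F; notypeclasses refine (is_derive_eqr _ _); first solve_derive => //.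
    by rewrite /=; field.
  by rewrite (pderiv_is_derive dF); ring.
rewrite (eq_bigr _ (fun i _ => FE i)) -mulr_suml.
have -> : \sum_(i < 3) d2flow R1 R2 0 (- 1) i i2 x = - 1.
  have r0 := rsq_neq0 R1_gt0 Dx.
  by rewrite sum3 /d2flow /drsq /daxial /=; rewrite /rsq in r0 *; field.
have R21 : 0 < (R2 ^+ 2 - R1 ^+ 2) * ln (R2 / R1).
  rewrite mulr_gt0// ?subr_gt0 ?ltr_pXn2r// ?nnegrE ?(ltW R1_gt0) ?(ltW R2_gt0)//.
  by rewrite ln_gt0// ltr_pdivlMr// mul1r.
rewrite mulN1r lerN2 -[8 / _]invf_div lef_pV2 ?posrE ?W0 ?divr_gt0//.
by have [] := torsion_bounds Dx.
Qed.

End Poincare.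

(** * The energy inequality *)

Section SobolevApproximation.
Context {R : realType}.
Variable D : set (R3 R).
Hypothesis oD : open D.
Implicit Types (f g V phi psi chi : R3 R -> R) (i : 'I_3).

Lemma weak_pderivP f i : H1 D f ->
  L2 D (weak_pderiv D i f) /\ is_weak_pderiv D i f (weak_pderiv D i f).
Proof. by move=> [_ /(_ i)]; exact: getPex. Qed.

(** Both sides equal minus the integral of f d_i psi. The equality is kept in tested form, which is
    all that the weak equation requires. *)
Lemma weak_pderiv_classical f V psi i : H1 D f -> smooth_on D V ->
  (forall x, D x -> V x = f x) -> test_function D psi ->
  ip D (pderiv i V) psi = ip D (weak_pderiv D i f) psi.
Proof.
move=> Hf sV Vf tpsi; have [_ wf] := weak_pderivP i Hf.
rewrite (ip_pderiv_test oD i sV tpsi) -[RHS]opprK; congr (- _).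
rewrite -[RHS](wf psi tpsi); apply: eq_ip => // x /[!inE]; exact: Vf.
Qed.

(** A function that is merely smooth on [D] may fail to be in L2; integrability comes from the
    support of [phi]. *)
Lemma ip_smoothD f g phi : smooth_on D f -> smooth_on D g -> test_function D phi ->
  ip D (f \+ g) phi = ip D f phi + ip D g phi.
Proof.
move=> sf sg tphi; have mD := open_measurable3 _ oD.
rewrite /ip -(RintegralD mD (smooth_mul_test_integrable oD sf tphi)
  (smooth_mul_test_integrable oD sg tphi)).
by apply: eq_Rintegral => x _ /=; rewrite mulrDl.
Qed.

Lemma ip_smooth_sum (F : 'I_3 -> R3 R -> R) phi : (forall i, smooth_on D (F i)) ->
  test_function D phi ->
  ip D (fun x => \sum_(i < 3) F i x) phi = \sum_(i < 3) ip D (F i) phi.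
Proof.
move=> sF tphi; rewrite sum3.
rewrite -(ip_smoothD (sF i0) (sF i1) tphi).
rewrite -(ip_smoothD (smooth_add _ _ _ oD (sF i0) (sF i1)) (sF i2) tphi).
by apply: eq_ip => // x _; rewrite sum3.
Qed.

Definition H1_approx (phi_ : nat -> R3 R -> R) f := [/\ forall n, test_function D (phi_ n),
  nrm D (phi_ n \- f) @[n --> \oo] --> 0 &
  forall i, nrm D (pderiv i (phi_ n) \- weak_pderiv D i f) @[n --> \oo] --> 0].

Lemma H10_approx f : H10 D f -> exists phi_ : nat -> R3 R -> R, H1_approx phi_ f.
Proof.
move=> [_ [phi_ [tphi cphi dphi]]]; exists phi_; split => // [|i].
  exact: nrm_cvg0.
exact: nrm_cvg0.
Qed.

Lemma nrm_cvg_bounded (f_ : nat -> R3 R -> R) f : (forall n, L2 D (f_ n)) -> L2 D f ->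
  nrm D (f_ n \- f) @[n --> \oo] --> 0 ->
  exists2 C : R, 0 <= C & forall n, nrm D (f_ n) <= C.
Proof.
move=> Lf_ Lf cf.
have /cvg_seq_bounded[B [Breal hB]] : cvgn (fun n => nrm D (f_ n \- f)).
  by apply/cvg_ex; exists 0.
exists (`|B| + 1 + nrm D f) => [|n]; first by rewrite !addr_ge0 ?nrm_ge0.
have Lfn := L2B (Lf_ n) Lf.
have -> : f_ n = (f_ n \- f) \+ f by apply/funext => x /=; rewrite subrK.
rewrite (le_trans (nrm_triangle oD Lfn Lf))// lerD2r.
rewrite (le_trans (ler_norm _))// (hB (`|B| + 1))//.
by rewrite ltr_pwDr ?ler_norm.
Qed.

Lemma Rintegral_test_sqr f : test_function D f ->
  \int[lebesgue3]_x (f x ^+ 2) = nrm D f ^+ 2.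
Proof.
move=> tf; rewrite (nrm_sq (L2_test oD tf)) /ip [RHS]Rintegral_mkcond; apply: eq_Rintegral => x _.
rewrite patchE; case: ifPn => [|/negP]; first by rewrite expr2.
by rewrite inE => /(test_outside _ _ _ tf) ->; rewrite expr0n.
Qed.

Definition fourth f : R := \int[lebesgue3]_x ((f x ^+ 2) ^+ 2).

Lemma fourth_bounded (phi_ : nat -> R3 R -> R) f : H1 D f -> H1_approx phi_ f ->
  exists2 L : R, 0 <= L & forall n, fourth (phi_ n) <= L.
Proof.
move=> Hf [tphi cphi dphi]; have [Lf _] := Hf.
have Lphi n := L2_test oD (tphi n).
have Ldphi i n := L2_test oD (test_pderiv _ _ i (tphi n)).
have [C C0 hC] := nrm_cvg_bounded Lphi Lf cphi.
have dC i : exists2 C : R, 0 <= C & forall n, nrm D (pderiv i (phi_ n)) <= C.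
  exact: (nrm_cvg_bounded (Ldphi i) (weak_pderivP i Hf).1 (dphi i)).
have [C2 C20 hC2] := dC i2; have [C0' C00 hC0] := dC i0; have [C1 C10 hC1] := dC i1.
exists (2 * (C ^+ 2 + C2 ^+ 2) * (C0' ^+ 2 + C1 ^+ 2)) => [|n].
  by rewrite mulr_ge0 ?mulr_ge0 ?addr_ge0 ?sqr_ge0.
have dc i := test_csupp (test_pderiv _ _ i (tphi n)).
have dd i x : derivable (phi_ n) x (unit_vec i).
  by apply: (smooth_derivable _ _ _ _ (test_smooth _ _ setT (tphi n))).
have H := ladyzhenskaya (test_csupp (tphi n)) dc dd.
rewrite [X in _ * (X + _) * _](Rintegral_test_sqr (tphi n)) in H.
rewrite [X in _ * (_ + X) * _](Rintegral_test_sqr (test_pderiv _ _ i2 (tphi n))) in H.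
rewrite [X in _ <= _ * (X + _)](Rintegral_test_sqr (test_pderiv _ _ i0 (tphi n))) in H.
rewrite [X in _ <= _ * (_ + X)](Rintegral_test_sqr (test_pderiv _ _ i1 (tphi n))) in H.
apply: (le_trans H).
have sq (a b : R) : 0 <= a -> a <= b -> a ^+ 2 <= b ^+ 2.
  by move=> a0 ab; rewrite lerXn2r ?nnegrE// (le_trans a0).
apply: ler_pM.
- by rewrite mulr_ge0// addr_ge0 ?sqr_ge0.
- by rewrite addr_ge0 ?sqr_ge0.
- by rewrite ler_pM2l// lerD// sq ?nrm_ge0.
- by rewrite lerD// sq ?nrm_ge0.
Qed.

Lemma L2_mul_test f chi : L2 D f -> test_function D chi -> L2 D (f \* chi).
Proof.
move=> Lf tchi; have [B B0 hB] := test_bounded tchi.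
apply: (L2_dominated (c := B) oD _ _ Lf).
  apply: measurable_funM; first exact: L2_measurable.
  exact: L2_measurable (L2_test oD tchi).
by move=> x _ /=; rewrite normrM mulrC ler_wpM2r.
Qed.

(* The L4 bounds of Ladyzhenskaya pass to f in the limit m -> oo, tested
   against the fixed bounded function chi. *)
Lemma nrm_mul_test_le f (phi_ : nat -> R3 R -> R) chi (L : R) : L2 D f ->
  (forall n, test_function D (phi_ n)) -> nrm D (phi_ n \- f) @[n --> \oo] --> 0 ->
  (forall n, fourth (phi_ n) <= L) -> fourth chi <= L -> 0 <= L ->
  test_function D chi -> nrm D (f \* chi) <= L + 1.
Proof.
move=> Lf tphi cphi hL chiL L0 tchi; have [B B0 hB] := test_bounded tchi.
have Lphi n := L2_test oD (tphi n).
have Lfc := L2_mul_test Lf tchi.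
have Lpc n := L2_mul_test (Lphi n) tchi.
have fourth_int g : test_function D g ->
    lebesgue3.-integrable setT (EFin \o (fun x => (g x ^+ 2) ^+ 2)).
  by move=> tg; exact: (csupp_integrable _ (csupp_sqr (csupp_sqr (test_csupp tg)))).
have pc n : nrm D (phi_ n \* chi) <= L + 1.
  have tpc : test_function D (phi_ n \* chi).
    by apply: test_mul => //; exact: test_smooth (tphi n).
  have sq : nrm D (phi_ n \* chi) ^+ 2 <= L.
    rewrite -(Rintegral_test_sqr tpc).
    apply: (@le_trans _ _ (2^-1 * (fourth (phi_ n) + fourth chi))); last first.
      by have := hL n; lra.
    rewrite /fourth -RintegralD//; [|exact: fourth_int|exact: fourth_int].
    have Is : lebesgue3.-integrable setT (EFin \o (fun x =>
        (phi_ n x ^+ 2) ^+ 2 + (chi x ^+ 2) ^+ 2)).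
      by have := integrableD measurableT (fourth_int _ (tphi n)) (fourth_int _ tchi);
        apply: eq_integrable.
    rewrite -RintegralZl//; apply: le_Rintegral => //.
    - exact: (csupp_integrable _ (csupp_sqr (test_csupp tpc))).
    - exact: (integrableZl measurableT 2^-1 Is).
    move=> x _ /=; rewrite exprMn.
    by have := sqr_ge0 (phi_ n x ^+ 2 - chi x ^+ 2); lra.
  (* From t^2 <= L one gets 2 t <= L + 1, a crude bound that avoids a square root. *)
  have := nrm_ge0 D (phi_ n \* chi); have := sqr_ge0 (nrm D (phi_ n \* chi) - 1).
  by move: sq; set t := nrm D _ => *; nra.
(* The error (phi_n - f) chi is controlled by the supremum [B] of [chi]; it vanishes in the limit,
   so [B] does not enter the final bound. *)
have bd n : nrm D (f \* chi) <= L + 1 + B * nrm D (phi_ n \- f).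
  have Ld := L2B (Lphi n) Lf.
  have Ldc := L2_mul_test Ld tchi.
  have -> : f \* chi = (phi_ n \* chi) \- ((phi_ n \- f) \* chi).
    by apply/funext => x /=; ring.
  apply: (le_trans (nrm_triangle oD (Lpc n) (L2N Ldc))).
  apply: lerD => //; apply: nrm_le => //; first exact: L2N.
  by move=> x _ /=; rewrite normrN normrM mulrC ler_wpM2r.
have cl : (L + 1 + B * nrm D (phi_ n \- f)) @[n --> \oo] --> L + 1.
  have := cvgD (cvg_cst (L + 1)) (cvgM (cvg_cst B) cphi).
  by rewrite mulr0 addr0; exact.
by apply: (cvgr_to_ge cl); apply: nearW => n; exact: bd.
Qed.

End SobolevApproximation.

(** * The energy balance of the perturbation *)

Section Energy.
Context {R : realType}.
Variables (R1 R2 alpha beta : R) (v : R3 R -> R3 R) (q : R3 R -> R).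
Hypotheses (R1_gt0 : 0 < R1) (R12 : R1 < R2).
Notation D := (annulus R1 R2).
Let u x := baseU R1 R2 alpha beta x + v x.
Let p x := baseP R1 R2 alpha beta x + q x.
Hypotheses (Vv : V0 D v) (Lq : L2 D q) (NS : classical_steady_NS D u p).
Notation flow := (flow R1 R2 alpha beta).
Notation dflow := (dflow R1 R2 alpha beta).
Notation pressure := (pressure R1 R2 alpha beta).
Notation vc k := (component v k).
Notation uc k := (component u k).
Notation g i k := (weak_pderiv D i (component v k)).
Implicit Types (i k : 'I_3) (phi : R3 R -> R).

Let oD : open D := @annulus_open R R1 R2.
Let mD := open_measurable3 _ oD.

Let su k : smooth_on D (uc k).
Proof. by have [/(_ k)[]] := NS. Qed.

Let sp : smooth_on D p.
Proof. by have [_ []] := NS. Qed.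

Let sflow k : smooth_on D (flow k) := smooth_flow alpha beta R1_gt0 k.

Lemma component_add (a b : R3 R -> R3 R) k x :
  component (fun y => a y + b y) k x = component a k x + component b k x.
Proof.
rewrite /component; have := coord3_linear k (a x) (b x) 1.
by rewrite scale1r mul1r.
Qed.

Lemma velocity_split k x : D x -> uc k x = flow k x + vc k x.
Proof.
move=> Dx; rewrite component_add.
by rewrite (baseU_flow alpha beta R1_gt0 R12 k Dx).
Qed.

(* V and Q are v and q on D, written in a form whose smoothness on D is clear. *)
Let V k : R3 R -> R := uc k \- flow k.
Let Q : R3 R -> R := p \- pressure.

Lemma smooth_V k : smooth_on D (V k).
Proof. exact (smooth_add _ _ _ oD (su k) (smooth_opp _ _ oD (sflow k))). Qed.

Let spressure : smooth_on D pressure := smooth_pressure alpha beta R1_gt0.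

Lemma smooth_Q : smooth_on D Q.
Proof. exact (smooth_add _ _ _ oD sp (smooth_opp _ _ oD spressure)). Qed.

Lemma V_eq k x : D x -> V k x = vc k x.
Proof. by move=> Dx; rewrite /V /= velocity_split// addrAC subrr add0r. Qed.

Lemma Q_eq x : D x -> Q x = q x.
Proof.
move=> Dx; rewrite /Q /p /= (baseP_pressure alpha beta R1_gt0 R12 Dx).
by rewrite addrAC subrr add0r.
Qed.

Let Hv k : H10 D (vc k) := Vv.1 k.
Let H1v k : H1 D (vc k) := (Hv k).1.
Let Lv k : L2 D (vc k) := (H1v k).1.
Let Lg i k : L2 D (g i k) := (weak_pderivP i (H1v k)).1.

Lemma pderiv_V i k x : D x -> pderiv i (V k) x = pderiv i (uc k) x - dflow i k x.
Proof.
move=> Dx; rewrite /V (pderivB _ _ _ _ _ (su k) (sflow k) Dx); congr (_ - _).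
exact/pderiv_is_derive/is_derive_flow.
Qed.

(** The equation of the base flow is subtracted, with u . grad u - U . grad U split as u . grad v +
    v . grad U. Keeping the full velocity u as the transporting field makes that term antisymmetric,
    because u is divergence free. *)
Lemma perturbation_eq k x : D x ->
  (\sum_(i < 3) (- pderiv i (pderiv i (V k)) x)) +
  (\sum_(i < 3) uc i x * pderiv i (V k) x) +
  (\sum_(i < 3) vc i x * dflow i k x) + pderiv k Q x = 0.
Proof.
move=> Dx; have [_ _ /(_ x Dx k) NSk _] := NS.
have base := flow_steady_NS alpha beta R1_gt0 k Dx.
have pQ : pderiv k Q x = pderiv k p x - dpressure R1 R2 alpha beta k x.
  rewrite /Q (pderivB _ _ _ _ _ sp spressure Dx); congr (_ - _).
  exact/pderiv_is_derive/is_derive_pressure.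
have lap : \sum_(i < 3) (- pderiv i (pderiv i (V k)) x) =
    - laplacian (uc k) x + laplacian (flow k) x.
  rewrite /laplacian -!sumrN -big_split/=; apply: eq_bigr => i _.
  have -> : pderiv i (pderiv i (V k)) x =
      pderiv i (pderiv i (uc k) \- pderiv i (flow k)) x.
    apply: (pderiv_open D) => // y Dy.
    by rewrite /V (pderivB _ _ _ _ _ (su k) (sflow k) Dy).
  rewrite (pderivB _ _ _ _ _ (smooth_pderiv _ _ i (su k)) (smooth_pderiv _ _ i (sflow k)) Dx).
  by rewrite opprB addrC.
have conv : \sum_(i < 3) uc i x * pderiv i (V k) x + \sum_(i < 3) vc i x * dflow i k x =
    convection u k x - \sum_(i < 3) flow i x * dflow i k x.
  rewrite /convection -sumrN -!big_split/=; apply: eq_bigr => i _.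
  rewrite pderiv_V// (velocity_split i Dx); ring.
have key (L1 L2 B C CV F DP DR : R) : B + C = CV - F -> - L1 + CV + DP = 0 ->
    - L2 + F + DR = 0 -> - L1 + L2 + B + C + (DP - DR) = 0 by lra.
by rewrite lap pQ; exact: (key _ _ _ _ _ _ _ _ conv NSk base).
Qed.

Lemma ip_pderiv_V i k phi : test_function D phi ->
  ip D (pderiv i (V k)) phi = ip D (g i k) phi.
Proof.
move=> tphi; apply: weak_pderiv_classical => //; first exact: smooth_V.
by move=> x; exact: V_eq.
Qed.

Definition shear k x : R := \sum_(i < 3) vc i x * dflow i k x.

Lemma smooth_dflow i k : smooth_on D (dflow i k).
Proof.
apply: (smooth_eq _ _ _ oD _ (smooth_pderiv _ _ i (sflow k))) => x Dx.
exact/pderiv_is_derive/is_derive_flow.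
Qed.

Lemma L2_vc_dflow i k : L2 D (fun x => vc i x * dflow i k x).
Proof.
have [C hC] := bounded_dflow alpha beta R1_gt0 R12 i k.
apply: (L2_dominated (c := C) oD _ _ (Lv i)).
  apply: measurable_funM; first exact: L2_measurable.
  by apply: continuous_measurable3 => // x Dx; exact: smooth_continuous (smooth_dflow i k) Dx.
by move=> x Dx; rewrite normrM mulrC ler_wpM2r// hC.
Qed.

Lemma L2_shear k : L2 D (shear k).
Proof.
have -> : shear k = (fun x => vc i0 x * dflow i0 k x) \+ (fun x => vc i1 x * dflow i1 k x)
    \+ (fun x => vc i2 x * dflow i2 k x) by apply/funext => x; rewrite /shear sum3.
by apply: L2D; [apply: L2D|]; exact: L2_vc_dflow.
Qed.

(** After integration by parts every function paired here is in L2 of the domain, and [v] enters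
    only through itself and its weak gradient; this prepares the passage to the limit. *)
Lemma weak_form k phi : test_function D phi ->
  (\sum_(i < 3) ip D (g i k) (pderiv i phi)) +
  (\sum_(i < 3) ip D (g i k) (uc i \* phi)) +
  ip D (shear k) phi - ip D q (pderiv k phi) = 0.
Proof.
move=> tphi.
have sddV i : smooth_on D (pderiv i (pderiv i (V k))).
  by apply: smooth_pderiv; apply: smooth_pderiv; exact: smooth_V.
have sA i : smooth_on D (fun x => - pderiv i (pderiv i (V k)) x).
  exact (smooth_opp _ _ oD (sddV i)).
have sB i : smooth_on D (fun x => uc i x * pderiv i (V k) x).
  exact (smooth_mul _ _ _ oD (su i) (smooth_pderiv _ _ i (smooth_V k))).
have sC i : smooth_on D (fun x => V i x * dflow i k x).
  exact (smooth_mul _ _ _ oD (smooth_V i) (smooth_dflow i k)).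
have ssum (F : 'I_3 -> R3 R -> R) : (forall i, smooth_on D (F i)) ->
    smooth_on D (fun x => \sum_(i < 3) F i x).
  move=> sF; apply: (smooth_eq _ ((F i0 \+ F i1) \+ F i2)) => //.
    by move=> x _; rewrite sum3.
  exact (smooth_add _ _ _ oD (smooth_add _ _ _ oD (sF i0) (sF i1)) (sF i2)).
have sdQ := smooth_pderiv _ _ k smooth_Q.
have E1 : \sum_(i < 3) ip D (g i k) (pderiv i phi) =
    ip D (fun x => \sum_(i < 3) (- pderiv i (pderiv i (V k)) x)) phi.
  rewrite (ip_smooth_sum oD sA tphi); apply: eq_bigr => i _.
  rewrite -(ip_pderiv_V i k (test_pderiv _ _ i tphi)).
  have := ip_pderiv_test oD i (smooth_pderiv _ _ i (smooth_V k)) tphi.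
  move/(congr1 -%R); rewrite opprK => <-.
  rewrite -mulN1r /ip.
  rewrite -(RintegralZl (-1) mD (smooth_mul_test_integrable oD (sddV i) tphi)).
  by apply: eq_Rintegral => x _; rewrite mulN1r mulNr.
have E2 : \sum_(i < 3) ip D (g i k) (uc i \* phi) =
    ip D (fun x => \sum_(i < 3) uc i x * pderiv i (V k) x) phi.
  rewrite (ip_smooth_sum oD sB tphi); apply: eq_bigr => i _.
  rewrite -(ip_pderiv_V i k (test_mul _ _ _ oD (su i) tphi)).
  by apply: eq_Rintegral => x _ /=; ring.
have E3 : ip D (shear k) phi = ip D (fun x => \sum_(i < 3) V i x * dflow i k x) phi.
  apply: eq_ip => // x /[!inE] Dx; rewrite /shear.
  by apply: eq_bigr => i _; rewrite V_eq.
have E4 : - ip D q (pderiv k phi) = ip D (pderiv k Q) phi.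
  rewrite (ip_pderiv_test oD k smooth_Q tphi); congr (- _).
  by apply: eq_ip => // x /[!inE] Dx; rewrite Q_eq.
rewrite E1 E2 E3 E4.
have sAB := smooth_add _ _ _ oD (ssum _ sA) (ssum _ sB).
have sABC := smooth_add _ _ _ oD sAB (ssum _ sC).
rewrite -(ip_smoothD oD (ssum _ sA) (ssum _ sB) tphi).
rewrite -(ip_smoothD oD sAB (ssum _ sC) tphi) -(ip_smoothD oD sABC sdQ tphi).
rewrite /ip.
transitivity (\int[lebesgue3]_(x in D) (0 : R)).
  apply: eq_Rintegral => x /[!inE] Dx /=.
  have := perturbation_eq k Dx.
  have -> : \sum_(i < 3) V i x * dflow i k x = \sum_(i < 3) vc i x * dflow i k x.
    by apply: eq_bigr => i _; rewrite V_eq.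
  by move=> ->; rewrite mul0r.
by rewrite (Rintegral_cst lebesgue3 mD) mul0r.
Qed.

(** The integrand is u . grad (phi^2 / 2), and div u = 0. *)
Lemma transport_antisymmetric phi : test_function D phi ->
  \sum_(i < 3) ip D (pderiv i phi) (uc i \* phi) = 0.
Proof.
move=> tphi; have sphi : smooth_on D phi := test_smooth _ _ D tphi.
have tphi2 := test_mul _ _ _ oD sphi tphi.
have sdu i : smooth_on D (pderiv i (uc i)) := smooth_pderiv _ _ i (su i).
have E i : ip D (pderiv i phi) (uc i \* phi) = - 2^-1 * ip D (pderiv i (uc i)) (phi \* phi).
  rewrite (ip_pderiv_test oD i (su i) tphi2) mulNr mulrN opprK.
  rewrite /ip -RintegralZl//; last first.
    exact: (smooth_mul_test_integrable oD (su i) (test_pderiv _ _ i tphi2)).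
  apply: eq_Rintegral => x /[!inE] Dx.
  by rewrite (pderivM _ _ _ _ _ sphi sphi Dx) /=; field.
rewrite (eq_bigr _ (fun i _ => E i)) -mulr_sumr -(ip_smooth_sum oD sdu tphi2).
have -> : ip D (fun x => \sum_(i < 3) pderiv i (uc i) x) (phi \* phi) =
    ip D (cst 0) (phi \* phi).
  apply: eq_ip => // x /[!inE] Dx; have [_ _ _ /(_ x Dx)] := NS; exact.
have -> : ip D (cst 0) (phi \* phi) = 0.
  transitivity (\int[lebesgue3]_(x in D) (0 : R)).
    by apply: eq_Rintegral => x _ /=; rewrite mul0r.
  by rewrite (Rintegral_cst lebesgue3 mD) mul0r.
by rewrite mulr0.
Qed.

Lemma L2_uc_mul i phi : test_function D phi -> L2 D (uc i \* phi).
Proof. by move=> tphi; apply: L2_test => //; exact: test_mul. Qed.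

(** With u = U + v, the part U phi_n is bounded because U is, and v_i phi_n by the L4 bounds on both
    approximating sequences. The constant [C] is uniform in n, which makes the transport term vanish
    in the limit. *)
Lemma nrm_transport_le i k (phi_ : nat -> R3 R -> R) (psi_ : nat -> R3 R -> R) (L : R) :
  H1_approx D phi_ (vc k) -> H1_approx D psi_ (vc i) ->
  (forall n, fourth (phi_ n) <= L) -> (forall n, fourth (psi_ n) <= L) -> 0 <= L ->
  exists2 C : R, 0 <= C & forall n, nrm D (uc i \* phi_ n) <= C.
Proof.
move=> [tphi cphi _] [tpsi cpsi _] phiL psiL L0.
have Lphi n := L2_test oD (tphi n).
have [A A0 hA] := nrm_cvg_bounded oD Lphi (Lv k) cphi.
have [C hC] := bounded_flow alpha beta R1_gt0 R12 i.
exists (`|C| * A + (L + 1)) => [|n]; first by rewrite !addr_ge0 ?mulr_ge0.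
have Lvp := L2_mul_test oD (Lv i) (tphi n).
have Lfp : L2 D (flow i \* phi_ n) by apply: L2_test => //; exact: test_mul.
have E : nrm D (uc i \* phi_ n) = nrm D ((flow i \* phi_ n) \+ (vc i \* phi_ n)).
  (* The two functions agree on the domain only, so their norms are compared through integrals over
     it. *)
  have sq : nrm D (uc i \* phi_ n) ^+ 2 = nrm D ((flow i \* phi_ n) \+ (vc i \* phi_ n)) ^+ 2.
    rewrite (nrm_sq (L2_uc_mul i (tphi n))) (nrm_sq (L2D Lfp Lvp)).
    by apply: eq_ip => x /[!inE] Dx /=; rewrite velocity_split// mulrDl.
  by apply/eqP; rewrite -(@eqrXn2 _ 2) ?nrm_ge0//; apply/eqP.
rewrite E (le_trans (nrm_triangle oD Lfp Lvp))// lerD//.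
  apply: (@le_trans _ _ (`|C| * nrm D (phi_ n))); last by rewrite ler_wpM2l.
  apply: nrm_le => // x Dx; rewrite /= normrM ler_wpM2r//.
  by rewrite (le_trans (hC x Dx))// ler_norm.
exact: (nrm_mul_test_le oD (Lv i) tpsi cpsi psiL (phiL n) L0 (tphi n)).
Qed.

Lemma ip_pressure_divergence : \sum_(k < 3) ip D q (g k k) = 0.
Proof.
have Lsum : L2 D ((g i0 i0 \+ g i1 i1) \+ g i2 i2) by apply: L2D; [exact: L2D|].
have -> : \sum_(k < 3) ip D q (g k k) = ip D q ((g i0 i0 \+ g i1 i1) \+ g i2 i2).
  transitivity (ip D (g i0 i0) q + ip D (g i1 i1) q + ip D (g i2 i2) q).
    by rewrite sum3; congr (_ + _ + _); exact: ipC.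
  have e1 := ipDl oD (L2D (Lg i0 i0) (Lg i1 i1)) (Lg i2 i2) Lq.
  have e2 := ipDl oD (Lg i0 i0) (Lg i1 i1) Lq.
  by rewrite [RHS]ipC; exact: (esym (etrans e1 (congr1 (fun t => t + _) e2))).
rewrite /ip /Rintegral.
rewrite (ae_eq_integral (cst 0%E) _ mD).
- by rewrite integral0.
- have /integrableP[mi _] := L2_mul_integrable oD Lq Lsum; exact: mi.
- exact: measurable_cst.
- have [_] := Vv; apply: negligibleS => x /= nx dx; apply: nx => Dx.
  by have := dx Dx; rewrite sum3 => ->; rewrite mulr0.
Qed.

Lemma cvg_sum3 (F : 'I_3 -> nat -> R) (l : 'I_3 -> R) :
  (forall i, F i n @[n --> \oo] --> l i) ->
  \sum_(i < 3) F i n @[n --> \oo] --> \sum_(i < 3) l i.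
Proof.
move=> Fl; rewrite sum3; under eq_fun do rewrite sum3.
exact: (cvgD (cvgD (Fl i0) (Fl i1)) (Fl i2)).
Qed.

(** The limit of the weak form tested with phi_n -> v_k. The pressure term survives in each single
    component and cancels only in the sum over [k]. *)
Lemma energy_component (phi : 'I_3 -> nat -> R3 R -> R) k :
  (forall i, H1_approx D (phi i) (vc i)) ->
  \sum_(i < 3) nrm D (g i k) ^+ 2 + ip D (shear k) (vc k) - ip D q (g k k) = 0.
Proof.
move=> hphi; have [tphi cphi dphi] := hphi k.
have hL i : exists L : R, 0 <= L /\ forall n, fourth (phi i n) <= L.
  by have [L L0 hL] := fourth_bounded oD (H1v i) (hphi i); exists L.
have [Li hLi] := choice hL.
have LiL i : Li i <= \sum_(j < 3) Li j.
  rewrite sum3; have [a0 _] := hLi i0; have [a1 _] := hLi i1; have [a2 _] := hLi i2.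
  by elim/all3: i; lra.
have L0 : 0 <= \sum_(j < 3) Li j by apply: sumr_ge0 => i _; have [] := hLi i.
have fL i n : fourth (phi i n) <= \sum_(j < 3) Li j.
  by apply: le_trans (LiL i); have [_] := hLi i.
have Lphi n := L2_test oD (tphi n).
have Ldphi i n := L2_test oD (test_pderiv _ _ i (tphi n)).
have Lup i n := L2_uc_mul i (tphi n).
(* [ip_cvg] takes two convergent sequences; a fixed factor enters it as a constant one. *)
have zero_cvg f : L2 D f -> nrm D (f \- f) @[n --> \oo] --> 0.
  move=> Lf; have -> : nrm D (f \- f) = 0; last exact: cvg_cst.
  apply/eqP; rewrite -sqrf_eq0 (nrm_sq (L2B Lf Lf)); apply/eqP.
  transitivity (\int[lebesgue3]_(x in D) (0 : R)).
    by apply: eq_Rintegral => x _; rewrite /= subrr mul0r.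
  by rewrite (Rintegral_cst lebesgue3 mD) mul0r.
have c1 i : ip D (g i k) (pderiv i (phi k n)) @[n --> \oo] --> nrm D (g i k) ^+ 2.
  rewrite (nrm_sq (Lg i k)).
  exact: (ip_cvg oD (fun=> Lg i k) (Ldphi i) (Lg i k) (Lg i k) (zero_cvg _ (Lg i k)) (dphi i)).
have c2 i : ip D (g i k \- pderiv i (phi k n)) (uc i \* phi k n) @[n --> \oo] --> 0.
  (* [phi k] is the sequence of test functions; [phi i] serves only for the L4 bound on v_i. *)
  have [C C0 hC] := nrm_transport_le (hphi k) (hphi i) (fL k) (fL i) L0.
  apply/norm_cvg0P.
  have cC : C * nrm D (pderiv i (phi k n) \- g i k) @[n --> \oo] --> 0.
    by have := cvgM (cvg_cst C) (dphi i); rewrite mulr0; exact.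
  apply: (squeeze_cvgr _ (cvg_cst 0) cC); apply: nearW => n; rewrite normr_ge0/=.
  have Ld := L2B (Ldphi i n) (Lg i k).
  have -> : g i k \- pderiv i (phi k n) = \- (pderiv i (phi k n) \- g i k).
    by apply/funext => x; rewrite /= opprB.
  apply: (le_trans (ip_cs oD (L2N Ld) (Lup i n))); rewrite mulrC.
  apply: ler_pM; rewrite ?nrm_ge0//.
  rewrite -[leRHS]mul1r; apply: nrm_le => //; first exact: L2N.
  by move=> x _; rewrite /= normrN mul1r.
have c3 : ip D (shear k) (phi k n) @[n --> \oo] --> ip D (shear k) (vc k).
  exact: (ip_cvg oD (fun=> L2_shear k) Lphi (L2_shear k) (Lv k) (zero_cvg _ (L2_shear k)) cphi).
have c4 : ip D q (pderiv k (phi k n)) @[n --> \oo] --> ip D q (g k k).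
  exact: (ip_cvg oD (fun=> Lq) (Ldphi k) Lq (Lg k k) (zero_cvg _ Lq) (dphi k)).
have := cvgB (cvgD (cvgD (cvg_sum3 c1) (cvg_sum3 c2)) c3) c4.
rewrite sumr_const mul0rn addr0.
pose total n := \sum_(i < 3) ip D (g i k) (pderiv i (phi k n)) +
    \sum_(i < 3) ip D (g i k \- pderiv i (phi k n)) (uc i \* phi k n) +
    ip D (shear k) (phi k n) - ip D q (pderiv k (phi k n)).
have total0 n : total n = 0.
  rewrite -[RHS](weak_form k (tphi n)) /total; congr (_ + _ + _ - _).
  transitivity (\sum_(i < 3) ip D (g i k) (uc i \* phi k n) -
      \sum_(i < 3) ip D (pderiv i (phi k n)) (uc i \* phi k n)).
    rewrite -sumrB; apply: eq_bigr => i _.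
    exact: (ipBl oD (Lg i k) (Ldphi i n) (Lup i n)).
  by rewrite (transport_antisymmetric (tphi n)) subr0.
move=> cvg_total; have c0 : total n @[n --> \oo] --> 0.
  by under eq_fun do rewrite total0; exact: cvg_cst.
exact: (cvg_unique (@Rhausdorff R) (cvg_total _ _ _) c0).
Qed.

Lemma energy_inequality :
  sqnorm_grad D v <= Mout R1 R2 alpha beta * sqnorm D v.
Proof.
have [phi hphi] := choice (fun k => H10_approx (Hv k)).
have EG : sqnorm_grad D v = \sum_(k < 3) - ip D (shear k) (vc k).
  have : \sum_(k < 3) (\sum_(i < 3) nrm D (g i k) ^+ 2 + ip D (shear k) (vc k)
      - ip D q (g k k)) = 0.
    by apply: big1 => k _; exact: energy_component hphi.
  rewrite sumrB ip_pressure_divergence subr0 big_split/= => /eqP.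
  by rewrite addr_eq0 -sumrN => /eqP.
have EN : sqnorm D v = \sum_(k < 3) ip D (vc k) (vc k).
  by apply: eq_bigr => k _; rewrite -nrm_sq.
rewrite EG EN sumrN lerNl !sum3.
have Is k := L2_mul_integrable oD (L2_shear k) (Lv k).
have Iv k := L2_mul_integrable oD (Lv k) (Lv k).
have Is2 : lebesgue3.-integrable D (EFin \o (fun x =>
    shear i0 x * vc i0 x + shear i1 x * vc i1 x)).
  by have := integrableD mD (Is i0) (Is i1); apply: eq_integrable.
have Iv2 : lebesgue3.-integrable D (EFin \o (fun x =>
    vc i0 x * vc i0 x + vc i1 x * vc i1 x)).
  by have := integrableD mD (Iv i0) (Iv i1); apply: eq_integrable.
have Is3 : lebesgue3.-integrable D (EFin \o (fun x =>
    shear i0 x * vc i0 x + shear i1 x * vc i1 x + shear i2 x * vc i2 x)).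
  by have := integrableD mD Is2 (Is i2); apply: eq_integrable.
have Iv3 : lebesgue3.-integrable D (EFin \o (fun x =>
    vc i0 x * vc i0 x + vc i1 x * vc i1 x + vc i2 x * vc i2 x)).
  by have := integrableD mD Iv2 (Iv i2); apply: eq_integrable.
have -> : ip D (vc i0) (vc i0) + ip D (vc i1) (vc i1) + ip D (vc i2) (vc i2) =
   \int[lebesgue3]_(x in D) (vc i0 x * vc i0 x + vc i1 x * vc i1 x + vc i2 x * vc i2 x).
  by rewrite (RintegralD mD Iv2 (Iv i2)) (RintegralD mD (Iv i0) (Iv i1)).
have -> : ip D (shear i0) (vc i0) + ip D (shear i1) (vc i1) + ip D (shear i2) (vc i2) =
   \int[lebesgue3]_(x in D)
     (shear i0 x * vc i0 x + shear i1 x * vc i1 x + shear i2 x * vc i2 x).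
  by rewrite (RintegralD mD Is2 (Is i2)) (RintegralD mD (Is i0) (Is i1)).
rewrite -mulNr -(RintegralZl (- Mout R1 R2 alpha beta) mD Iv3).
apply: le_Rintegral => //.
  exact: (integrableZl mD (- Mout R1 R2 alpha beta) Iv3).
move=> x Dx; have := shear_bound alpha beta R1_gt0 R12 (v x) Dx.
by rewrite /shear !sum3 -!expr2 mulNr.
Qed.

End Energy.

(** * Rigidity *)

Section Conclusion.
Context {R : realType}.
Notation mu := (@lebesgue_measure R).
Notation mR := (measurableTypeR R).

Lemma poincare_V0 (D : set (R3 R)) (lambda : R) (v : R3 R -> R3 R) : open D ->
  (forall phi, test_function D phi ->
    lambda * ip D phi phi <= \sum_(i < 3) ip D (pderiv i phi) (pderiv i phi)) ->
  V0 D v -> lambda * sqnorm D v <= sqnorm_grad D v.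
Proof.
move=> oD poinc [Hv _]; rewrite /sqnorm mulr_sumr; apply: ler_sum => k _.
have Hk := Hv k; have H1k := Hk.1; have Lk := H1k.1.
have Lg i : L2 D (weak_pderiv D i (component v k)) := (weak_pderivP i H1k).1.
have [phi [tphi cphi dphi]] := H10_approx Hk.
have Lphi n := L2_test oD (tphi n).
have Ldphi i n := L2_test oD (test_pderiv _ _ i (tphi n)).
have c1 : lambda * ip D (phi n) (phi n) @[n --> \oo] -->
    lambda * ip D (component v k) (component v k).
  have cp := ip_cvg oD Lphi Lphi Lk Lk cphi cphi.
  by have := cvgM (cvg_cst lambda) cp; exact.
have c2 : \sum_(i < 3) ip D (pderiv i (phi n)) (pderiv i (phi n)) @[n --> \oo] -->
    \sum_(i < 3) ip D (weak_pderiv D i (component v k)) (weak_pderiv D i (component v k)).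
  apply: cvg_sum3 => i.
  exact: (ip_cvg oD (Ldphi i) (Ldphi i) (Lg i) (Lg i) (dphi i) (dphi i)).
have -> : \sum_(i < 3) fine (L2norm D (weak_pderiv D i (component v k))) ^+ 2 =
    \sum_(i < 3) ip D (weak_pderiv D i (component v k)) (weak_pderiv D i (component v k)).
  by apply: eq_bigr => i _; exact: nrm_sq.
rewrite (_ : fine _ ^+ 2 = ip D (component v k) (component v k)); last exact: nrm_sq.
by apply: (ler_cvg_to c1 c2); apply: nearW => n; exact: poinc.
Qed.

Lemma open_not_negligible (U : set (R3 R)) x : open U -> U x ->
  ~ (@lebesgue3 R).-negligible U.
Proof.
move=> oU Ux; have := open_nbhs_nbhs (conj oU Ux).
rewrite -nbhs_ballE => -[e /= e0 eU].
pose I (a : R) : set mR := `]a - e, a + e[%classic.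
pose B := I x.1.1 `*` I x.1.2 `*` I x.2.
have mI a : measurable (I a) by exact: measurable_itv.
have muI a : mu (I a) = (e *+ 2)%:E.
  rewrite /I lebesgue_measure_itv/= lte_fin ltrD2l gtrN// -EFinB; congr (_%:E).
  by rewrite mulr2n; lra.
have BU : B `<=` U.
  move=> [[a b] c] [[/=]]; rewrite /I /= !in_itv/= => xa yb zc; apply: eU.
  by split; [split|]; rewrite /ball/= ltr_distl; lra.
have mB : @measurable _ (R3 mR) B by apply: measurableX => //; exact: measurableX.
have muB : lebesgue3 B = (e *+ 2 * (e *+ 2) * (e *+ 2))%:E.
  rewrite /lebesgue3 /B product_measure1E//=; last exact: measurableX.
  by rewrite product_measure1E//= !muI -!EFinM.
move=> /(negligibleS BU) /negligibleP => /(_ mB) B0.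
have := etrans (esym muB) B0 => /eqP; rewrite eqe !mulf_eq0 !orbb mulrn_eq0/=.
by rewrite gt_eqF.
Qed.

(** [F] is the copy of [f] whose continuity is known. The subset of [D] where it is nonzero is open
    and of measure zero, hence empty. *)
Lemma continuous_ip_eq0 (D : set (R3 R)) (f F : R3 R -> R) : open D ->
  (forall x, D x -> {for x, continuous F}) -> (forall x, D x -> F x = f x) ->
  L2 D f -> ip D f f = 0 -> forall x, D x -> f x = 0.
Proof.
move=> oD cF Ff Lf f0 x Dx; have mD := open_measurable3 _ oD.
apply: contrapT => fx0.
have : (@lebesgue3 R).-negligible [set y | D y /\ F y != 0].
  have /integrableP[mff _] := L2_mul_integrable oD Lf Lf.
  have Iff := L2_mul_integrable oD Lf Lf.
  have If0 : (\int[lebesgue3]_(x in D) (f x * f x)%R%:E = 0)%E.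
    rewrite -(fineK (integrable_fin_num mD Iff)).
    by rewrite (_ : fine _ = ip D f f)// f0.
  have : (\int[lebesgue3]_(x in D) `|(f x * f x)%R%:E| = 0)%E.
    rewrite -[RHS]If0; apply: eq_integral => y _.
    by rewrite /= ger0_norm// -expr2 sqr_ge0.
  move=> /(ae_eq_integral_abs _ mD mff); apply: negligibleS => y /= [Dy Fy] H.
  have := H Dy; rewrite /= => -[] /eqP; rewrite mulf_eq0 orbb -Ff//.
  exact/negP.
apply: (@open_not_negligible _ x); last first.
  by split => //; rewrite Ff//; apply/eqP.
rewrite openE => y [Dy Fy]; apply: filterI; first exact: open_nbhs_nbhs.
apply: (cF y Dy (fun t => t != 0)); apply: open_nbhs_nbhs; split => //.
Qed.

(* Otherwise |f| is bounded below on a vertical strip of infinite measure. *)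
Lemma z_invariant_L2_eq0 (R1 R2 : R) (f : R3 R -> R) :
  (forall x, annulus R1 R2 x -> {for x, continuous f}) -> L2 (annulus R1 R2) f ->
  (forall x y z z', annulus R1 R2 (x, y, z) -> f (x, y, z) = f (x, y, z')) ->
  forall x, annulus R1 R2 x -> f x = 0.
Proof.
set D := annulus R1 R2 => cf Lf fz x Dx.
have oD : open D := @annulus_open R R1 R2; have mD := open_measurable3 _ oD.
apply/eqP/negPn/negP => fx0; pose c := `|f x| / 2.
have c0 : 0 < c by rewrite divr_gt0 ?normr_gt0.
have : nbhs x (D `&` [set y | c < `|f y|]).
  apply: filterI; first exact: open_nbhs_nbhs.
  have : \forall t \near nbhs (f x), c < `|t|.
    have cn := @norm_continuous _ R (f x).
    apply: (cn [set t | c < t]); apply: open_nbhs_nbhs; split; first exact: open_gt.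
    by rewrite /c /= ltr_pdivrMr// mulr2n mulrDr mulr1 ltrDl normr_gt0.
  exact: (cf x Dx).
rewrite -nbhs_ballE => -[e /= e0 eU].
pose I (a : R) : set mR := `]a - e, a + e[%classic.
pose B := I x.1.1 `*` I x.1.2 `*` [set: mR].
have mI a : measurable (I a) by exact: measurable_itv.
have muI a : mu (I a) = (e *+ 2)%:E.
  rewrite /I lebesgue_measure_itv/= lte_fin ltrD2l gtrN// -EFinB; congr (_%:E).
  by rewrite mulr2n; lra.
have mB : @measurable _ (R3 mR) B by apply: measurableX => //; exact: measurableX.
have BD y : B y -> D y /\ c < `|f y|.
  move: y => [[a b] z] [[/=]]; rewrite /I /= !in_itv/= => xa yb _.
  (* Neither [D] nor [f] depends on the height, so the point is moved vertically to the height of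
     [x], where it lies in the ball. *)
  have /eU[Dy fy] : ball x e (a, b, x.2).
    split; [split|]; rewrite /ball/= ?subrr ?normr0// ltr_distl; lra.
  by split => //; rewrite (fz _ _ _ x.2).
have muB : lebesgue3 B = +oo%E.
  rewrite /lebesgue3 /B product_measure1E//=; last exact: measurableX.
  rewrite product_measure1E//= !muI -set_itvNyy lebesgue_measure_itv/=.
  by rewrite -EFinM gt0_muley// lte_fin mulr_gt0// mulrn_wgt0.
have If := L2_mul_integrable oD Lf Lf.
have /integrableP[mff ioo] := If.
have : (\int[lebesgue3]_(y in B) (c ^+ 2)%:E < +oo)%E.
  apply: le_lt_trans ioo.
  apply: (@le_trans _ _ (\int[lebesgue3]_(y in B) `|(f y * f y)%R%:E|)%E).
    apply: ge0_le_integral => //.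
    - by move=> y _; rewrite lee_fin sqr_ge0.
    - apply: measurableT_comp => //.
      by apply: measurable_funS mff => // y /BD[].
    - move=> y /BD[_ cy]; rewrite /= lee_fin normrM -expr2.
      by rewrite lerXn2r ?nnegrE// ltW.
  apply: ge0_subset_integral => //; first exact: measurableT_comp.
  by move=> y /BD[].
rewrite integral_cst// [X in (_ * X)%E](_ : _ = +oo%E)//.
by rewrite gt0_muley// lte_fin exprn_gt0.
Qed.

Lemma ae0_ip_eq0 (D : set (R3 R)) (f : R3 R -> R) : open D -> L2 D f ->
  {ae @lebesgue3 R, forall x, D x -> f x = 0} -> ip D f f = 0.
Proof.
move=> oD Lf f0; have mD := open_measurable3 _ oD.
rewrite /ip /Rintegral (ae_eq_integral (cst 0%E) _ mD).
- by rewrite integral0.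
- by have /integrableP[mi _] := L2_mul_integrable oD Lf Lf; exact: mi.
- exact: measurable_cst.
- apply: negligibleS f0 => x /= nx fx; apply: nx => Dx.
  by rewrite fx// mulr0.
Qed.

End Conclusion.

Lemma coord3_eq0 (R : realType) (w : R3 R) : (forall k, coord3 k w = 0) -> w = 0.
Proof.
move: w => [[a b] c] w0.
by have := w0 i0; have := w0 i1; have := w0 i2; rewrite /coord3 !(tnth_nth 0)/= => -> -> ->.
Qed.

(** * From a Poincare constant to the vanishing of the perturbation *)

Section Rigidity.
Context {R : realType}.
Variables (R1 R2 alpha beta : R) (v : R3 R -> R3 R) (q : R3 R -> R).
Hypotheses (R1_gt0 : 0 < R1) (R12 : R1 < R2).
Notation D := (annulus R1 R2).
Let u x := baseU R1 R2 alpha beta x + v x.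
Let p x := baseP R1 R2 alpha beta x + q x.
Hypotheses (Vv : V0 D v) (Lq : L2 D q) (NS : classical_steady_NS D u p).
Let oD : open D := @annulus_open R R1 R2.

Lemma sqnorm_ge0 : 0 <= sqnorm D v.
Proof. by apply: sumr_ge0 => k _; exact: sqr_ge0. Qed.

Lemma sqnorm_eq0 : sqnorm D v = 0 -> forall x, D x -> v x = 0 /\ q x = 0.
Proof.
move=> n0.
pose V k := component u k \- flow R1 R2 alpha beta k.
pose Q := p \- pressure R1 R2 alpha beta.
have sV k : smooth_on D (V k) := smooth_V R1_gt0 NS k.
have sQ : smooth_on D Q := smooth_Q R1_gt0 NS.
have VE k x : D x -> V k x = component v k x := V_eq alpha beta v R1_gt0 R12 k (x := x).
have QE x : D x -> Q x = q x := Q_eq alpha beta q R1_gt0 R12 (x := x).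
have Lv k : L2 D (component v k) := (Vv.1 k).1.1.
have ip0 k : ip D (component v k) (component v k) = 0.
  rewrite -(nrm_sq (Lv k)); apply/eqP.
  have := n0 => /eqP; rewrite psumr_eq0 => [|j _]; last exact: sqr_ge0.
  by move=> /allP/(_ k); rewrite mem_index_enum => /(_ isT).
have v0 k x : D x -> component v k x = 0.
  apply: (continuous_ip_eq0 oD _ (VE k) (Lv k) (ip0 k)) => y Dy.
  exact: (smooth_continuous _ _ _ (sV k) Dy).
have dQ k x : D x -> pderiv k Q x = 0.
  move=> Dx; have := perturbation_eq R1_gt0 R12 NS k Dx.
  have dV0 i y : D y -> pderiv i (V k) y = 0.
    move=> Dy; rewrite (pderiv_open D (V k) (cst 0)) ?pderiv_cst// => z Dz.
    by rewrite VE// v0.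
  rewrite !big1 ?add0r// => i _.
  - by rewrite v0// mul0r.
  - by rewrite dV0// mulr0.
  - by rewrite (pderiv_open D (pderiv i (V k)) (cst 0)) ?pderiv_cst ?oppr0//; exact: dV0.
have Qz x y z z' : D (x, y, z) -> Q (x, y, z) = Q (x, y, z').
  (* The domain contains the whole vertical line through each of its points, so the derivative in z
     vanishes on all of it. *)
  move=> Dz; have Dt t : D (x, y, t) by [].
  apply: (@is_derive_0_is_cst _ (fun t => Q (x, y, t))) => t.
  rewrite -(dQ i2 _ (Dt t)); apply: is_derive_slice2.
  exact: (smooth_derivable _ _ _ _ sQ (Dt t)).
have LQ : L2 D Q.
  have E : Q \_ D = q \_ D.
    by apply/funext => x; rewrite !patchE; case: ifPn => // /[!inE] /QE ->.
  by rewrite /L2 E.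
have Q0 := z_invariant_L2_eq0 (fun x Dx => smooth_continuous _ _ _ sQ Dx) LQ Qz.
move=> x Dx; split; last by rewrite -QE// Q0.
by apply: coord3_eq0 => k; exact: v0.
Qed.

Lemma rigidity (lambda : R) : lambda * sqnorm D v <= sqnorm_grad D v ->
  Mout R1 R2 alpha beta < lambda -> forall x, D x -> v x = 0 /\ q x = 0.
Proof.
move=> hl Ml; apply: sqnorm_eq0; apply/eqP; rewrite eq_le sqnorm_ge0 andbT.
have := le_trans hl (energy_inequality R1_gt0 R12 Vv Lq NS).
by rewrite -subr_ge0 -mulrBl nmulr_rge0 ?subr_lt0.
Qed.

Lemma Lambda_le : Lambda D * sqnorm D v <= sqnorm_grad D v.
Proof.
have [n0|n0] := eqVneq (sqnorm D v) 0.
  rewrite n0 mulr0; apply: sumr_ge0 => k _; apply: sumr_ge0 => i _; exact: sqr_ge0.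
have npos : 0 < sqnorm D v by rewrite lt_neqAle eq_sym n0 sqnorm_ge0.
rewrite -ler_pdivlMr//; apply: ge_inf.
  exists 0 => _ [w _ <-]; apply: divr_ge0; last first.
    by apply: sumr_ge0 => k _; exact: sqr_ge0.
  by apply: sumr_ge0 => k _; apply: sumr_ge0 => i _; exact: sqr_ge0.
exists v => //; split => // v0; move/eqP: n0; apply; apply: big1 => k _.
have Lv : L2 D (component v k) := (Vv.1 k).1.1.
rewrite (_ : fine _ ^+ 2 = ip D (component v k) (component v k)); last exact: nrm_sq.
apply: ae0_ip_eq0 => //; apply: negligibleS v0 => x /= nx vx; apply: nx => Dx.
rewrite /component vx//; have := coord3_linear k (0 : R3 R) 0 (- 1).
by rewrite scaler0 addr0 mulN1r addNr.
Qed.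

End Rigidity.

Theorem theorem3p2 (R : realType) (R1 R2 alpha beta : R)
    (v : R3 R -> R3 R) (q : R3 R -> R) :
  0 < R1 -> R1 < R2 ->
  let Omega := annulus R1 R2 in
  let u := fun x => baseU R1 R2 alpha beta x + v x in
  let p := fun x => baseP R1 R2 alpha beta x + q x in
  V0 Omega v -> L2 Omega q ->
  classical_steady_NS Omega u p ->
  (forall x, cylinder R1 x -> u x = alpha *: e_theta x) ->
  (forall x, cylinder R2 x -> u x = 0) ->
  (Mout R1 R2 alpha beta < Lambda Omega ->
     forall x, Omega x -> v x = 0 /\ q x = 0) /\
  (Mout R1 R2 alpha beta <
     Num.max (pi ^+ 2 / (2 * R2 ^+ 2))
             (8 / ((R2 ^+ 2 - R1 ^+ 2) * ln (R2 / R1))) ->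
     forall x, Omega x -> v x = 0 /\ q x = 0).
Proof.
move=> R1_gt0 R12 Omega u p Vv Lq NS _ _.
have oD : open Omega := @annulus_open R R1 R2.
split; first exact: (rigidity R1_gt0 R12 Vv Lq NS (Lambda_le Vv)).
(* Each of the two numbers is a Poincare constant on V0, so [rigidity] applies to it directly. A
   lower bound on [Lambda] would in addition require a nonzero element of V0, since the infimum of
   the empty set is 0. *)
rewrite lt_max => /orP[].
- apply: (rigidity R1_gt0 R12 Vv Lq NS).
  by apply: (poincare_V0 oD _ Vv) => phi; exact: poincare_pi.
- apply: (rigidity R1_gt0 R12 Vv Lq NS).
  by apply: (poincare_V0 oD _ Vv) => phi; exact: poincare_log.
Qed.
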